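(* Assume that the vectors $C_1, C'_1, C_2, C'_2$ satisfy the following conditions: \begin{eqnarray} &Q(C_1),\ Q(C'_1), \ Q(C_2),\ Q(C'_2)>0, \\ &\Delta_{11'22'}>0, \\ &D_{11'},\ D_{22'}\geq 0, \\ & {\operatorname M} \mbox{ is negative definite}, \end{eqnarray} where ${\operatorname M}$ is the symmetric matrix \begin{equation} {\operatorname M}= \begin{pmatrix} \Delta_{1'22'} & 0 & D_{12} & D_{12'} \\ 0 & \Delta_{122'} & D_{1'2} & D_{1'2'} \\ D_{12} & D_{1'2} & \Delta_{11'2'} & 0 \\ D_{12'}& D_{1'2'} & 0 & \Delta_{11'2} \end{pmatrix}. \end{equation} Then the theta series $\vartheta_{\mu}[\Phi_2,0]$ with kernel \begin{equation} \Phi_2(x) = \frac14\,\Bigl[ \operatorname{sign} B(C_1,x)-\operatorname{sign} B(C'_1,x) \Bigr] \, \Bigl[\operatorname{sign} B(C_2,x)-\operatorname{sign} B(C'_2,x)\Bigr] \end{equation} is convergent. Moreover, it is holomorphic in $\tau$ and $z$ (in the sense that the function $\tilde\vartheta_\mu(\tau,z)$ defined by $\vartheta_{\mu}(\tau,b,c)=e^{\mathrm{i}\pi B(b,b\tau-c)}\tilde\vartheta_\mu(\tau,z)$, $z=b\tau-c$, is holomorphic), away from the loci where $B(C,k+b)=0$ for $C\in\{C_1,C'_1,C_2,C'_2\}$ and $k\in\Lambda+\mu+\tfrac12 p$.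
   Context: Let $\Lambda$ be an $n$-dimensional lattice with symmetric bilinear form $B$ whose quadratic form $Q(x)=B(x,x)$ is integer valued on $\Lambda$ and has signature $(2,n-2)$. Let $p\in\Lambda$ be a characteristic vector ($Q(k)+B(k,p)\in2\mathbb{Z}$ for all $k\in\Lambda$), $\mu\in\Lambda^*/\Lambda$, $\lambda\in\mathbb{Z}$, $q=e^{2\pi\mathrm{i}\tau}$, $\tau=\tau_1+\mathrm{i}\tau_2$ in the upper half plane, $b,c\in\Lambda\otimes\mathbb{R}$, $\mathbf{e}(x)=e^{2\pi\mathrm{i} x}$, and \begin{equation} \vartheta_{\mu}[\Phi,\lambda](\tau, b, c)=\tau_2^{-\lambda/2} \sum_{k\in \Lambda+\mu+\frac{1}{2}p} (-1)^{B(k,p)}\,\Phi(\sqrt{2\tau_2}(k+b))\, q^{-\frac12 Q(k+b)}\,\mathbf{e}\bigl(B(c,k+\tfrac{1}{2}b)\bigr). \end{equation} $C_1,C'_1,C_2,C'_2\in\Lambda\otimes\mathbb{R}$; write $C_{j'}=C'_j$. For a subset $\mathcal{I}\subset\{1,1',2,2'\}$, $\Delta_{\mathcal{I}}$ denotes the determinant of the Gram matrix $B(C_i,C_j)_{i,j\in\mathcal{I}}$, and $D_{ij}$ denote the off-diagonal cofactors of the $4\times4$ Gram matrix $B(C_i,C_j)_{i,j\in\{1,1',2,2'\}}$.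
   Formalization: The prefactor is taken as $e^{-i\pi B(b,b\tau-c)}$: with the printed plus sign $\tilde\vartheta_\mu$ is not holomorphic where the series is nonzero; holomorphy away from the loci means on every open set that avoids them. *)

(* Defs.v *)
From mathcomp Require Import all_boot all_order all_algebra.
From mathcomp Require Import all_classical all_reals all_analysis.
From mathcomp Require Import complex.
From mathcomp.analysis.showcase Require summability.

Set Implicit Arguments.
Unset Strict Implicit.
Unset Printing Implicit Defensive.

Import Order.TTheory GRing.Theory Num.Theory.
Import numFieldNormedType.Exports.
Local Open Scope classical_set_scope.
Local Open Scope ring_scope.
Local Open Scope complex_scope.

(* R[i] packed as a numFieldType, so that its topology and its normed module
   structure over itself (hence complex differentiability) are inferred. *)
Definition Cplx (R : realType) : numFieldType := R[i].

Definition cexp (R : realType) (z : Cplx R) : Cplx R :=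
  (expR (complex.Re z) * cos (complex.Im z))
    +i* (expR (complex.Re z) * sin (complex.Im z)).

(* The function e(x) = exp(2 pi i x). *)
Definition ee (R : realType) (x : Cplx R) : Cplx R :=
  cexp ((2 * pi)%:C * 'i%C * x).

(* [differentiable] over the base field [Cplx R] is complex-linear (Frechet)
   differentiability. *)
Definition holomorphic_on (R : realType) (V W : normedModType (Cplx R))
    (U : set V) (f : V -> W) : Prop :=
  open U /\ forall x, U x -> differentiable f x.

(* A basis of the lattice is fixed: Lambda = Z^n is 'rV[int]_n and
   Lambda (x) R is 'rV[R]_n, which carries the form B. *)
Section Lattice.
Variables (R : realType) (n : nat) (B : {symmetric 'rV[R]_n}).
Local Notation V := 'rV[R]_n.

Definition vec (k : 'rV[int]_n) : V := map_mx intr k.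

Definition quad (x : V) : R := B x x.

Definition integer_valued : Prop :=
  forall k : 'rV[int]_n, quad (vec k) \is a Num.int.

(* The rows of P are a B-orthogonal basis with r vectors of positive and
   s vectors of negative square. *)
Definition has_signature (r s : nat) : Prop :=
  exists P : 'M[R]_n,
    [/\ P \in unitmx,
        forall i j : 'I_n, i != j -> B (row i P) (row j P) = 0,
        #|[set i : 'I_n | 0 < quad (row i P)]%SET| = r
      & #|[set i : 'I_n | quad (row i P) < 0]%SET| = s].

Definition characteristic (p : 'rV[int]_n) : Prop :=
  forall k : 'rV[int]_n, exists m : int,
    quad (vec k) + B (vec k) (vec p) = (2 * m)%:~R.

Definition dual_lattice : set V :=
  [set x | forall k : 'rV[int]_n, B x (vec k) \is a Num.int].

(* The point of Lambda + mu + p/2 with label l in Lambda. *)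
Definition shifted (mu : V) (p l : 'rV[int]_n) : V :=
  vec l + mu + 2^-1 *: vec p.

(* Since B(k,p) may be a half-integer on Lambda + mu + p/2, the sign
   (-1)^B(k,p) is exp(i pi B(k,p)); likewise q^x is exp(2 pi i tau x). *)
Definition theta_term (Phi : V -> Cplx R) (mu : V) (p : 'rV[int]_n)
    (tau : Cplx R) (b c : V) (l : 'rV[int]_n) : Cplx R :=
  let k := shifted mu p l in
  cexp ((pi * B k (vec p))%:C * 'i%C)
  * Phi (Num.sqrt (2 * complex.Im tau) *: (k + b))
  * ee (tau * (- (2^-1 * quad (k + b)))%:C)
  * ee ((B c (k + 2^-1 *: b))%:C).

Definition theta (Phi : V -> Cplx R) (lambda : int) (mu : V)
    (p : 'rV[int]_n) (tau : Cplx R) (b c : V) : Cplx R :=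
  (complex.Im tau `^ (- (lambda%:~R / 2)))%:C
  * (summability.sum (theta_term Phi mu p tau b c) : Cplx R).

(* Absolute convergence, and convergence of the net of finite partial sums
   whose limit is [summability.sum]. *)
Definition theta_convergent (Phi : V -> Cplx R) (mu : V)
    (p : 'rV[int]_n) (tau : Cplx R) (b c : V) : Prop :=
  summable [set: 'rV[int]_n]
    (fun l => (complex.Re `|theta_term Phi mu p tau b c l|)%:E)
  /\ cvg (summability.partial_sum (theta_term Phi mu p tau b c)
          @ summability.totally).

Definition cvec (x : V) : 'rV[Cplx R]_n := map_mx (real_complex R) x.

(* The point z = b tau - c of Lambda (x) C. *)
Definition zvar (tau : Cplx R) (b c : V) : 'rV[Cplx R]_n :=
  tau *: cvec b - cvec c.

(* The C-linear extension of B in its second argument. For z = b tau - c,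
   - tau Q(k+b) / 2 + B(c, k + b/2) = - tau Q(k) / 2 - B(k, z) - B(b, z) / 2,
   so exp(- i pi B(b, z)) is the non-holomorphic factor of the theta terms. *)
Definition complexified_form (x : V) (z : 'rV[Cplx R]_n) : Cplx R :=
  B x (map_mx (@complex.Re R) z) +i* B x (map_mx (@complex.Im R) z).

Definition gram (s : seq V) : 'M[R]_(size s) :=
  \matrix_(i, j) B (nth 0 s i) (nth 0 s j).

Definition Delta (s : seq V) : R := \det (gram s).

(* Rows and columns of the 4 x 4 Gram matrix are numbered 0, 1, 2, 3 for the
   indices 1, 1', 2, 2'. *)
Definition Dcof (C1 C1' C2 C2' : V) (i j : nat) : R :=
  cofactor (gram [:: C1; C1'; C2; C2']) (inord i) (inord j).

Definition Mmat (C1 C1' C2 C2' : V) : 'M[R]_4 :=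
  let D := Dcof C1 C1' C2 C2' in
  let rows :=
    [:: [:: Delta [:: C1'; C2; C2']; 0; (D 0 2)%N; (D 0 3)%N];
        [:: 0; Delta [:: C1; C2; C2']; (D 1 2)%N; (D 1 3)%N];
        [:: (D 0 2)%N; (D 1 2)%N; Delta [:: C1; C1'; C2']; 0];
        [:: (D 0 3)%N; (D 1 3)%N; 0; Delta [:: C1; C1'; C2]]] in
  \matrix_(i, j) nth 0 (nth [::] rows i) j.

Definition Phi2 (C1 C1' C2 C2' x : V) : Cplx R :=
  (4^-1 * (Num.sg (B C1 x) - Num.sg (B C1' x))
        * (Num.sg (B C2 x) - Num.sg (B C2' x)))%:C.

(* The pairs (tau, z) lying on none of the loci B(C, k + b) = 0. *)
Definition off_loci (Cs : seq V) (mu : V) (p : 'rV[int]_n) :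
    set (Cplx R * 'rV[Cplx R]_n) :=
  [set x | 0 < complex.Im x.1 /\
    forall b c : V, x.2 = zvar x.1 b c ->
    forall C, C \in Cs -> forall l : 'rV[int]_n,
      B C (shifted mu p l + b) != 0].

End Lattice.

Definition negative_definite (R : realType) (m : nat) (M : 'M[R]_m) : Prop :=
  forall v : 'rV[R]_m, v != 0 -> (v *m M *m v^T) 0 0 < 0.

(* Main.v *)
Require Import Defs.
From HB Require Import structures.
From mathcomp Require Import all_boot all_order all_algebra finmap.
From mathcomp Require Import all_classical all_reals all_analysis.
From mathcomp Require Import complex ring lra.
From mathcomp.analysis.showcase Require summability.
Import Order.TTheory GRing.Theory Num.Theory.
Import numFieldNormedType.Exports.
Local Open Scope classical_set_scope.
Local Open Scope ring_scope.
Local Open Scope complex_scope.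

Set Implicit Arguments.
Unset Strict Implicit.
Unset Printing Implicit Defensive.

(** Write D for the adjugate of the Gram matrix G of C1, C1', C2, C2'. The
    component of x in their span has square b D b^T / det G, where b lists the
    B(C, x), and
      b D b^T = b M b^T + 2 D_11' B(C1,x) B(C1',x) + 2 D_22' B(C2,x) B(C2',x).
    Where the kernel does not vanish both products are nonpositive, so this is
    negative; since the four vectors span signature (2,2), the orthogonal
    component is negative too. By compactness Q(x) <= - e |x|^2 on the support
    of the kernel, so the series is dominated by a Gaussian sum over Z^n.

    A term of the series for theta_tilde at x + h is the term at x times the
    exponential of a linear form L_l(h) with |L_l(h)| <= c (1 + |l|^2) |h|, as
    soon as the kernel takes the same value at both points. Off the loci it
    does: along a segment inside U the sign of B(C, k + b) is that of an affine
    function without zeros. The Gaussian decay absorbs the remainder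
    4 |L_l(h)|^2 exp |L_l(h)| of the exponential, so the termwise derivative is
    the Frechet derivative. *)

#[local] Existing Instance summability.totally_filter.

(** * The cone estimate *)

(** Along the segment from the identity to [A] the determinant is a polynomial in t with value 1 at
    t = 0. Were it negative at t = 1, it would vanish at some t in [0, 1]. A kernel vector v there
    gives (1 - t) |v|^2 + t (v A v^T) = 0 with both summands nonnegative, so t = 1 and [A] itself is
    singular. *)
Lemma psd_det_ge0 (R : rcfType) m (A : 'M[R]_m) :
  (forall v : 'rV[R]_m, 0 <= (v *m A *m v^T) 0 0) -> 0 <= \det A.
Proof.
move=> A_psd; rewrite leNgt; apply/negP => detA_lt0.
pose P : 'M[{poly R}]_m :=
  (1 - 'X) *: 1%:M + 'X *: map_mx polyC A.
have PE t : (\det P).[t] = \det ((1 - t) *: 1%:M + t *: A).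
  rewrite -/(horner_eval t _) -det_map_mx; congr (\det _).
  apply/matrixP => i j; rewrite !mxE /= /horner_eval.
  by rewrite !(hornerE, hornerMn).
have ivt : (- \det P).[0] <= 0 <= (- \det P).[1].
  rewrite !hornerN !PE subr0 subrr !scale1r !scale0r addr0 add0r det1.
  by rewrite oppr_le0 ler01 oppr_ge0 ltW.
have [t /andP[t0 t1]] := poly_ivt ler01 ivt.
rewrite rootN /root PE => /det0P[v v0 vA].
have : (v *m ((1 - t) *: 1%:M + t *: A) *m v^T) 0 0 = 0 by rewrite vA mul0mx
  mxE.
rewrite mulmxDr mulmxDl -!scalemxAr -!scalemxAl mulmx1 !mxE => /eqP.
have vv : 0 < \sum_j v 0 j * v^T j 0.
  have /rV0Pn[j vj] := v0.
  rewrite (bigD1 j) //= ltr_wpDr // ?mxE.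
    by apply: sumr_ge0 => i _; rewrite mxE -expr2 sqr_ge0.
  by rewrite -expr2 exprn_even_gt0.
have vAv : 0 <= \sum_j (v *m A) 0 j * v^T j 0 by have := A_psd v; rewrite !mxE.
rewrite paddr_eq0 ?mulr_ge0 ?subr_ge0 // ?(ltW vv) // mulf_eq0 (gt_eqF vv) orbF.
rewrite subr_eq0 => /andP[/eqP t1' _].
move: vA; rewrite -t1' subrr scale0r add0r scale1r => vA.
suff /eqP : \det A = 0 by rewrite lt_eqF.
by apply/eqP/det0P; exists v.
Qed.

(** * Forms of signature (2, n - 2) and the cone defined by four vectors *)

Section QuadraticForm.
Variables (R : realType) (n : nat) (B : {symmetric 'rV[R]_n}).
Local Notation V := 'rV[R]_n.
Local Notation Q := (quad B).
Implicit Types (x y : V) (s : seq V).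

Lemma formC x y : B x y = B y x.
Proof. by rewrite hermC expr0 mul1r. Qed.

Lemma formDl z x y : B (x + y) z = B x z + B y z.
Proof. exact: linearDl. Qed.

Lemma formZl z a x : B (a *: x) z = a * B x z.
Proof. exact: linearZl_LR. Qed.

Lemma formDr z x y : B z (x + y) = B z x + B z y.
Proof. exact: linearDr. Qed.

Lemma formZr z a x : B z (a *: x) = a * B z x.
Proof. by rewrite formC formZl formC. Qed.

Lemma formBr z x y : B z (x - y) = B z x - B z y.
Proof. exact: linearBr. Qed.

Lemma formBl z x y : B (x - y) z = B x z - B y z.
Proof. exact: linearBl. Qed.

Lemma form_suml z I (r : seq I) (P : pred I) (F : I -> V) :
  B (\sum_(i <- r | P i) F i) z = \sum_(i <- r | P i) B (F i) z.
Proof. exact: linear_sumlz. Qed.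

Lemma quadD x y : Q (x + y) = Q x + 2 * B x y + Q y.
Proof. rewrite /quad formDl !formDr (formC y x); ring. Qed.

Lemma quadZ a x : Q (a *: x) = a ^+ 2 * Q x.
Proof. by rewrite /quad formZl formZr mulrA. Qed.

(** Some nontrivial combination w of the three vectors has no coordinate along the two positive
    basis vectors, so Q(w) <= 0. Orthogonality gives Q(w) = sum v_i^2 Q(u_i) >= 0. Hence w = 0, and
    the coefficients of the two vectors of positive square vanish, which leaves a nonzero multiple
    of the last one. *)
Lemma signature2_no_triple (u : 'I_3 -> V) :
  has_signature B 2 (n - 2) ->
  (forall i j, i != j -> B (u i) (u j) = 0) ->
  (forall i, 0 <= Q (u i)) -> (forall i, i != ord_max -> 0 < Q (u i)) ->
  u ord_max = 0.
Proof.
move=> [P [P_unit P_orth pos2 neg2]] u_orth u_ge0 u_gt0.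
set Sp := [set i | 0 < Q (row i P)]%SET in pos2.
set Sn := [set i | Q (row i P) < 0]%SET in neg2.
have n2 : (2 <= n)%N by rewrite -pos2 -[leqRHS]card_ord max_card.
(* The counts 2 and n - 2 exhaust the basis, so no basis vector has square zero. *)
have SpnT : Sn =i ~: Sp.
  apply/subset_cardP; last first.
    by apply/fintype.subsetP => i; rewrite !inE => /lt_gtF ->.
  by rewrite [RHS]cardsCs finset.setCK card_ord -/Sp pos2.
pose X := \matrix_(i < 3) (u i *m invmx P).
have uE i : u i = \sum_j X i j *: row j P.
  rewrite -[LHS]mulmx1 -(mulVmx P_unit) mulmxA mulmx_sum_row.
  by apply: eq_bigr => j _; rewrite [X i j]mxE.
have QE (x : 'rV[R]_n) :
    Q (\sum_j x 0 j *: row j P) = \sum_j x 0 j ^+ 2 * Q (row j P).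
  rewrite {1}/quad form_suml; apply: eq_bigr => j _.
  rewrite formC form_suml (bigD1 j) //= big1 => [|i ij].
    by rewrite addr0 !formZl formZr mulrA.
  by rewrite formZl formZr P_orth // !mulr0.
(* Three rows but only two columns: the left kernel of [Y] supplies the combination. *)
pose Y : 'M[R]_(3, #|Sp|) := \matrix_(i, j) X i (enum_val j).
have : kermx Y != 0.
  rewrite kermx_eq0 /row_free; apply: contraTneq (rank_leq_col Y) => ->.
  by rewrite pos2.
case/rowV0Pn => v /sub_kermxP vY v0.
have wE : \sum_i v 0 i *: u i = \sum_j (v *m X) 0 j *: row j P.
  under eq_bigr => i _ do rewrite uE scaler_sumr.
  rewrite exchange_big /=; apply: eq_bigr => j _.
  by rewrite [(v *m X) 0 j]mxE scaler_suml; apply: eq_bigr => i _;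
    rewrite scalerA.
have vX0 j : j \in Sp -> (v *m X) 0 j = 0.
  move=> jS; have /matrixP/(_ 0 (enum_rank_in jS j)) := vY.
  rewrite [LHS]mxE [RHS]mxE => <-; rewrite [LHS]mxE; apply: eq_bigr => i _.
  by rewrite [Y i _]mxE enum_rankK_in.
have Qw : Q (\sum_i v 0 i *: u i) = \sum_i v 0 i ^+ 2 * Q (u i).
  rewrite {1}/quad form_suml; apply: eq_bigr => i _.
  rewrite formC form_suml (bigD1 i) //= big1 => [|j ij].
    by rewrite addr0 !formZl formZr mulrA.
  by rewrite formZl formZr u_orth // !mulr0.
have QP_lt0 j : j \notin Sp -> Q (row j P) < 0.
  by have := SpnT j; rewrite !inE => ->.
have Qw0 : \sum_i v 0 i ^+ 2 * Q (u i) = 0.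
  apply/eqP; rewrite eq_le -{1}Qw wE QE sumr_ge0 ?andbT => [|i _]; last first.
    by rewrite mulr_ge0 ?sqr_ge0.
  rewrite -oppr_ge0 -sumrN sumr_ge0 // => j _; rewrite -mulrN.
  have [/vX0->|/QP_lt0 lt0] := boolP (j \in Sp); first by rewrite expr0n mul0r.
  by rewrite mulr_ge0 ?sqr_ge0 // oppr_ge0 ltW.
have w0 : \sum_i v 0 i *: u i = 0.
  rewrite wE big1 // => j _.
  have [/vX0->|jS] := boolP (j \in Sp); first by rewrite scale0r.
  have : \sum_j (v *m X) 0 j ^+ 2 * - Q (row j P) = 0.
    by under eq_bigr do rewrite mulrN; rewrite sumrN -QE -wE Qw Qw0 oppr0.
  move=> /eqP; rewrite psumr_eq0 => [/allP/(_ j)|i _].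
    rewrite mem_index_enum mulf_eq0 oppr_eq0 (lt_eqF (QP_lt0 _ jS)) orbF.
    by move=> /(_ isT); rewrite sqrf_eq0 => /eqP->; rewrite scale0r.
  have [/vX0->|/QP_lt0 lt0] := boolP (i \in Sp); first by rewrite expr0n mul0r.
  by rewrite mulr_ge0 ?sqr_ge0 // oppr_ge0 ltW.
have vi0 i : i != ord_max -> v 0 i = 0.
  move=> im; move/eqP: Qw0; rewrite psumr_eq0 => [/allP/(_ i)|j _].
    rewrite mem_index_enum mulf_eq0 (gt_eqF (u_gt0 _ im)) orbF.
    by move=> /(_ isT); rewrite sqrf_eq0 => /eqP.
  by rewrite mulr_ge0 ?sqr_ge0.
move: w0; rewrite (bigD1 ord_max) //= big1 => [|i /vi0->]; last exact: scale0r.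
rewrite addr0 => /eqP; rewrite scaler_eq0 => /orP[/eqP vm|/eqP //].
case/eqP: v0; apply/rowP => i; rewrite mxE.
by have [->|/vi0] := eqVneq i ord_max.
Qed.

Definition comb s (v : 'rV[R]_(size s)) : V := \sum_i v 0 i *: s`_i.

Lemma gram_sym s : (gram B s)^T = gram B s.
Proof. by apply/matrixP => i j; rewrite !mxE formC. Qed.

Lemma form_comb s (v : 'rV_(size s)) x : B (comb v) x = \sum_i v 0 i * B s`_i x.
Proof. by rewrite form_suml; apply: eq_bigr => i _; rewrite formZl. Qed.

Lemma form_comb_nth s (v : 'rV_(size s)) (j : 'I_(size s)) :
  B (comb v) s`_j = (v *m gram B s) 0 j.
Proof. by rewrite form_comb mxE; apply: eq_bigr => i _; rewrite mxE. Qed.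

Lemma quad_comb s (v : 'rV_(size s)) :
  Q (comb v) = (v *m gram B s *m v^T) 0 0.
Proof.
rewrite /quad formC form_comb [RHS]mxE; apply: eq_bigr => j _.
by rewrite formC form_comb_nth [v^T _ _]mxE mulrC.
Qed.

(* Otherwise the form [- Q + 2 B(C1, .)^2 / Q(C1)] would be positive
   semidefinite on the span of the four vectors; its Gram determinant is minus
   theirs. *)
Lemma perp_quad_lt0 C1 C2 C3 C4 x : has_signature B 2 (n - 2) ->
  0 < Q C1 -> 0 < Delta B [:: C1; C2; C3; C4] ->
  (forall C, C \in [:: C1; C2; C3; C4] -> B C x = 0) -> x != 0 -> Q x < 0.
Proof.
move=> sig C1_gt0 Delta_gt0 Cx x0; rewrite ltNge; apply/negP => Qx.
(* A vector [y] of positive square would form with [C1] and [x] a triple that the signature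
   forbids. *)
have perp_le0 y : B C1 y = 0 -> B x y = 0 -> Q y <= 0.
  move=> C1y xy; rewrite leNgt; apply/negP => Qy.
  case/eqP: x0; apply: (@signature2_no_triple
    (fun i => [:: C1; y; x]`_i)) => //.
  - move=> [[|[|[|//]]] ?] [[|[|[|//]]] ?] //= _; rewrite ?C1y ?xy //.
    + by rewrite Cx // inE eqxx.
    + by rewrite formC.
    + by rewrite formC.
    + by rewrite formC Cx // inE eqxx.
  - by move=> [[|[|[|//]]] ?] //=; exact: ltW.
  - by move=> [[|[|[|//]]] ?].
set s := [:: C1; C2; C3; C4] in Cx Delta_gt0 *.
set G := gram B s.
pose a : 'cV[R]_(size s) := delta_mx ord0 0.
(* [v *m S] lists the coefficients of the reflection of [comb v] in the hyperplane orthogonal to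
   [C1]. Only the first column differs from the identity, so [S] is lower triangular with diagonal
   -1, 1, 1, 1. *)
pose S := 1%:M - (2 / Q C1) *: (G *m a *m a^T).
have GaE i : (G *m a) i 0 = B s`_i C1.
  rewrite mxE (bigD1 ord0) //= !mxE !eqxx mulr1 big1 ?addr0 // => j j0.
  by rewrite [a _ _]mxE (negbTE j0) mulr0.
have SE i j : S i j = (i == j)%:R - 2 / Q C1 * (B s`_i C1 * (j == ord0)%:R).
  rewrite [LHS]mxE [1%:M _ _]mxE; congr (_ + _).
  by rewrite mxE; congr (- _);
    rewrite mxE [X in _ * X]mxE big_ord1 GaE !mxE eqxx andbT.
have detS : \det S = -1.
  rewrite det_trig.
    rewrite /= !big_ord_recl big_ord0 !SE /=.
    rewrite !mulr0 !subr0 !mulr1 -/(Q C1) -mulrA mulVf ?gt_eqF //.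
    ring.
  apply/is_trig_mxP => i j ij; rewrite SE.
  have /negbTE-> : i != j by apply: contraTneq ij => ->; rewrite ltnn.
  have /negbTE-> : j != ord0 by apply: contraTneq ij => ->; rewrite ltn0.
  by rewrite !mulr0 subrr.
have : 0 <= \det (- (S *m G)).
  apply: psd_det_ge0 => v; rewrite mulmxN mulNmx mxE oppr_ge0.
  have -> : (v *m (S *m G) *m v^T) 0 0
      = Q (comb v) - 2 / Q C1 * B (comb v) C1 ^+ 2.
    rewrite mulmxA /S mulmxBr mulmx1 !mulmxBl -scalemxAr -!scalemxAl.
    rewrite [LHS]mxE -quad_comb; congr (_ + _); rewrite mxE; congr (- _);
      rewrite mxE.
    congr (_ * _).
    have GvE : v *m G *m a = (B (comb v) C1)%:M.
      apply/matrixP => i j; rewrite !ord1 -[C1]/(s`_(@ord0 (size s).-1)).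
      rewrite form_comb_nth -/G [LHS]mxE [RHS]mxE mulr1n.
      rewrite (bigD1 ord0) //= big1 => [|k k0].
        by rewrite addr0 [a _ _]mxE !eqxx mulr1.
      by rewrite [a _ _]mxE (negbTE k0) mulr0.
    have -> : v *m (G *m a *m a^T) *m G *m v^T
        = (v *m G *m a) *m (v *m G *m a)^T.
      by rewrite !trmx_mul (gram_sym s : G^T = G) !mulmxA.
    by rewrite GvE tr_scalar_mx -scalar_mxM mxE mulr1n expr2.
  set w := comb v.
  (* The component of [w] orthogonal to [C1]. It is orthogonal to [x] as well, since [x] is
     orthogonal to the whole span, so [perp_le0] applies to it. *)
  pose w' := w - (B w C1 / Q C1) *: C1.
  have Qw : Q w = Q w' + B w C1 ^+ 2 / Q C1.
    rewrite {2}/quad /w' !(formBl, formBr, formZl, formZr) -!/(Q _) (formC C1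
      w).
    field; exact: lt0r_neq0.
  have : Q w' <= 0.
    apply: perp_le0.
      rewrite /w' formBr formZr -/(Q C1) formC divfK ?subrr //;
        exact: lt0r_neq0.
    rewrite /w' formBr formZr formC form_comb (formC x) Cx ?mulr0 ?subr0 ?inE
      ?eqxx //.
    by rewrite big1 // => i _; rewrite Cx ?mulr0 // mem_nth.
  have : 0 <= B w C1 ^+ 2 / Q C1 by rewrite divr_ge0 ?sqr_ge0 ?ltW.
  rewrite Qw (mulrAC 2) -mulrA; lra.
rewrite -scaleN1r detZ det_mulmx detS -/(Delta B s) /=.
move: Delta_gt0; rewrite !exprS expr0; lra.
Qed.

(** This matches the diagonal of [Mmat] with that of the adjugate of the Gram matrix; the cofactor
    sign is an even power of -1. *)
Lemma Dcof_diag C1 C1' C2 C2' (i : nat) :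
  (i < 4)%N ->
  Dcof B C1 C1' C2 C2' i i
  = Delta B [:: nth 0 [:: C1'; C1; C1; C1] i; nth 0 [:: C2; C2; C1'; C1'] i;
                nth 0 [:: C2'; C2'; C2'; C2] i].
Proof.
move=> i4; rewrite /Dcof /cofactor addnn -mul2n exprM sqrrN expr1n expr1n mul1r.
congr (\det _); apply/matrixP => a b; rewrite !mxE /= /bump inordK //.
by case: i i4 => [|[|[|[|//]]]] _; case: a => [[|[|[|//]]] ?];
  case: b => [[|[|[|//]]] ?].
Qed.

Lemma DcofC C1 C1' C2 C2' i j :
  Dcof B C1 C1' C2 C2' i j = Dcof B C1 C1' C2 C2' j i.
Proof.
by rewrite /Dcof -[in LHS]gram_sym cofactor_tr.
Qed.

Lemma cone_quad_lt0 C1 C1' C2 C2' x : has_signature B 2 (n - 2) ->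
  0 < Q C1 -> 0 < Delta B [:: C1; C1'; C2; C2'] ->
  0 <= Dcof B C1 C1' C2 C2' 0%N 1%N -> 0 <= Dcof B C1 C1' C2 C2' 2%N 3%N ->
  negative_definite (Mmat B C1 C1' C2 C2') ->
  B C1 x * B C1' x <= 0 -> B C2 x * B C2' x <= 0 -> x != 0 -> Q x < 0.
Proof.
move=> sig C1_gt0 Delta_gt0 D01 D23 Mneg cone1 cone2 x0.
set s := [:: C1; C1'; C2; C2'] in Delta_gt0 *.
set G := gram B s.
pose b : 'rV[R]_(size s) := \row_i B s`_i x.
(* [comb v] is the orthogonal projection of [x] to the span: its products with the four vectors are
   [v *m G = b]. *)
pose v := b *m invmx G.
have G_unit : G \in unitmx by rewrite unitmxE unitfE gt_eqF.
have Bs (i : 'I_(size s)) : B s`_i (x - comb v) = 0.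
  by rewrite formBr [B _ (comb v)]formC form_comb_nth /v mulmxKV // mxE subrr.
have Qx : Q x = Q (comb v) + Q (x - comb v).
  rewrite -[x in LHS](subrKC (comb v)) [LHS]quadD form_comb big1 ?mulr0 ?addr0
    // => i _.
  by rewrite Bs mulr0.
set D := Dcof B C1 C1' C2 C2'.
have adjE i j : (\adj G) i j = D i j.
  by rewrite mxE /D DcofC /Dcof !inord_val.
have sum4 (A : 'M[R]_4) (w : 'rV[R]_4) : (w *m A *m w^T) 0 0
    = \sum_i \sum_j w 0 j * A j i * w 0 i.
  rewrite mxE; apply: eq_bigr => i _; rewrite mxE [w^T _ _]mxE mulr_suml.
  by apply: eq_bigr => j _.
(* [Mmat] is the adjugate with the entries 11' and 22' set to zero; these entries return as the two
   products that the cone conditions control. *)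
have Qv : Q (comb v) = (Delta B s)^-1 *
    ((b *m Mmat B C1 C1' C2 C2' *m b^T) 0 0
     + 2 * D 0%N 1%N * (B C1 x * B C1' x) + 2 * D 2%N 3%N * (B C2 x * B C2' x)).
  rewrite quad_comb /v mulmxKV // trmx_mul trmx_inv gram_sym mulmxA.
  rewrite /invmx G_unit -scalemxAr -scalemxAl mxE; congr (_ * _).
  rewrite !sum4 !big_ord_recl !big_ord0 !adjE.
  have Mb (i : 'I_4) : b 0 i = B s`_i x by rewrite mxE.
  rewrite !Mb !mxE /= /bump /=.
  have Dd i := @Dcof_diag C1 C1' C2 C2' i.
  rewrite -(Dd 0%N isT) -(Dd 1%N isT) -(Dd 2%N isT) -(Dd 3%N isT) -!/(D _ _).
  have DC i j : D i j = D j i by exact: DcofC.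
  rewrite !add1n (DC 1 0)%N (DC 2 0)%N (DC 3 0)%N (DC 2 1)%N (DC 3 1)%N (DC 3
    2)%N.
  ring.
(* If [b] vanishes, [x] is itself orthogonal to the span and strictness comes from [perp_quad_lt0];
   otherwise it comes from [Mmat]. *)
have [b0|b0] := eqVneq b 0.
  apply: (perp_quad_lt0 sig C1_gt0 Delta_gt0) => // C Cs.
  have /(nthP 0)[i i_lt <-] := Cs.
  by have /rowP/(_ (Ordinal i_lt)) := b0; rewrite !mxE.
have Qperp : Q (x - comb v) <= 0.
  have [->|y0] := eqVneq (x - comb v) 0; first by rewrite /quad linear0r.
  apply/ltW/(perp_quad_lt0 sig C1_gt0 Delta_gt0) => // C /(nthP 0)[i i_lt <-].
  exact: (Bs (Ordinal i_lt)).
rewrite Qx ltr_wnDr // Qv pmulr_rlt0 ?invr_gt0 //.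
have := Mneg b b0.
have := mulr_ge0_le0 D01 cone1; have := mulr_ge0_le0 D23 cone2.
rewrite -/D; lra.
Qed.

(** * Continuity of the form and the uniform bound on the cone *)

Lemma form_coordE C x : B C x = \sum_j x 0 j * B C 'e_j.
Proof.
by rewrite formC [x in LHS]row_sum_delta form_suml; apply: eq_bigr => j _;
  rewrite formZl formC.
Qed.

(** The norm of a matrix is the sup norm. A general [numFieldType] lets the bound serve both real
    and complex vectors. *)
Lemma mx_coord_le (K : numFieldType) m1 m2 (M : 'M[K]_(m1, m2)) i j :
  `|M i j| <= `|M|.
Proof.
apply/ler_addgt0Pr => e e0.
have : ball_ Num.norm (0 : 'M[K]_(m1, m2)) (`|M| + e) M.
  by rewrite /ball_ /= sub0r normrN ltrDl.
rewrite -mx_norm_ball => -[_ /(_ i j)].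
by rewrite -ball_normE /= mxE sub0r normrN => /ltW.
Qed.

Lemma form_le C x : `|B C x| <= (\sum_j `|B C 'e_j|) * `|x|.
Proof.
rewrite form_coordE (le_trans (ler_norm_sum _ _ _)) // mulr_suml ler_sum // =>
  j _.
by rewrite normrM mulrC ler_wpM2l ?mx_coord_le.
Qed.

Lemma form_continuous C : continuous (B C : V -> R).
Proof.
rewrite (_ : (B C : V -> R) = (fun x => \sum_j x 0 j * B C 'e_j)); last first.
  by apply/funext => x; exact: form_coordE.
move=> x; apply: (cvg_big _ (nbhs_filter x)) => [|j _];
  first exact: add_continuous.
by apply: cvgM; [exact: coord_continuous | exact: cvg_cst].
Qed.

Lemma quad_continuous : continuous (Q : V -> R).
Proof.
rewrite (_ : (Q : V -> R) = (fun x => \sum_j x 0 j * B 'e_j x)); last first.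
  by apply/funext => x; rewrite /quad form_coordE; apply: eq_bigr => j _;
    rewrite formC.
move=> x; apply: (cvg_big _ (nbhs_filter x)) => [|j _];
  first exact: add_continuous.
by apply: cvgM; [exact: coord_continuous | exact: form_continuous].
Qed.

(** The cone is closed and stable under scaling, and both sides have degree 2, so it is enough to
    look at the unit sphere. There the cone is compact, and -e is the maximum of Q. *)
Lemma cone_quad_le C1 C1' C2 C2' :
  (forall x, B C1 x * B C1' x <= 0 -> B C2 x * B C2' x <= 0 -> x != 0 ->
     Q x < 0) ->
  exists2 e : R, 0 < e & forall x,
    B C1 x * B C1' x <= 0 -> B C2 x * B C2' x <= 0 -> Q x <= - (e * `|x| ^+ 2).
Proof.
move=> cone_lt0.
pose K : set V := [set x | `|x| = 1] `&`
  ([set x | B C1 x * B C1' x <= 0] `&` [set x | B C2 x * B C2' x <= 0]).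
have K_normalize x : B C1 x * B C1' x <= 0 -> B C2 x * B C2' x <= 0 ->
    x != 0 -> K (`|x|^-1 *: x).
  move=> c1 c2 x0; split => /=.
    by rewrite normrZ normfV normr_id mulVf // normr_eq0.
  have x2 : 0 <= `|x|^-1 ^+ 2 by rewrite sqr_ge0.
  have scaled a b : a * b <= 0 -> (`|x|^-1 * a) * (`|x|^-1 * b) <= 0.
    by move=> ab; rewrite mulrACA -expr2 mulr_ge0_le0.
  by split=> /=; rewrite 2!formZr scaled.
(* An empty slice means that the cone is reduced to 0, where any constant works. *)
have [K0|K0] := pselect (K !=set0); last first.
  exists 1 => // x c1 c2; have [->|x0] := eqVneq x 0.
    by rewrite /quad linear0r normr0 expr0n mulr0 oppr0.
  by exfalso; apply: K0; exists (`|x|^-1 *: x); exact: K_normalize.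
have K_compact : compact K.
  apply: bounded_closed_compact.
    exists 1; split => // M M1 x [/= -> _]; exact: ltW.
  apply: closedI.
    apply: (preimage_closed _ (@closed_eq _ 1)) => x _; exact: norm_continuous.
  apply: closedI; apply: (preimage_closed _ (@closed_le _ 0)) => x _;
    apply: (@continuousM _ _ (B _) (B _)); exact: form_continuous.
have [c cK Qc] := EVT_max_rV K0 K_compact (continuous_subspaceT
  quad_continuous).
move: cK; rewrite inE => -[/= c1 [cone1 cone2]].
have c0 : c != 0 by rewrite -normr_eq0 c1 oner_eq0.
exists (- Q c) => [|x x1 x2]; first by rewrite oppr_gt0 cone_lt0.
have [->|x0] := eqVneq x 0.
  by rewrite /quad linear0r normr0 expr0n mulr0 oppr0.
rewrite mulNr opprK -{1}[x](scalerKV (_ : `|x| != 0)) ?normr_eq0 // quadZ mulrC.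
by rewrite ler_wpM2r ?sqr_ge0 // Qc // inE; exact: K_normalize.
Qed.

End QuadraticForm.

(** * Gaussian sums over the lattice *)

Lemma sumr_inj_le (F : numDomainType) (I J : finType) (h : I -> J) (g : J -> F)
  :
  injective h -> (forall y, 0 <= g y) -> \sum_x g (h x) <= \sum_y g y.
Proof.
move=> h_inj g_ge0.
rewrite -(big_imset g (fun x y _ _ => @h_inj x y) (A := predT)) /=.
by rewrite [leRHS](bigID (mem (h @: predT))) /= lerDl sumr_ge0.
Qed.

Lemma sum_geometric_le (F : realFieldType) (r : F) N :
  0 <= r -> r < 1 -> \sum_(i < N) r ^+ i <= (1 - r)^-1.
Proof.
move=> r0 r1; have r1' : 0 < 1 - r by rewrite subr_gt0.
rewrite -(ler_pM2r r1') mulVf ?gt_eqF // mulrC -[X in _ - X]mul1r -opprB mulNr.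
rewrite mul1r -subrX1 opprB lerBlDr lerDl exprn_ge0 //.
Qed.

(** For integer vectors n |l|^2 >= sum l_i^2 >= sum |l_i| in the sup norm, so each term is at most a
    product of powers r^|l_i|. The sum over a box factors into n two-sided geometric sums. Dividing
    by n + 1 instead of n covers n = 0. *)
Lemma gaussian_lattice_sum (R : realType) n (a : R) : 0 < a ->
  exists K : R, forall A : {fset 'rV[int]_n},
    \sum_(l : A) expR (- (a * `|vec R (val l)| ^+ 2)) <= K.
Proof.
move=> a0; pose c := a / n.+1%:R.
have c0 : 0 < c by rewrite divr_gt0.
pose r := expR (- c).
have r0 : 0 <= r by exact: expR_ge0.
have r1 : r < 1 by rewrite -expR0 ltr_expR oppr_lt0.
exists ((2 * (1 - r)^-1) ^+ n) => A.
pose N := (\max_(l : A) \max_(i < n) `|val l 0%R i|%N).+1.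
have lN (l : A) i : (`|val l 0%R i| < N)%N.
  by rewrite ltnS (leq_trans _ (leq_bigmax l)) // (leq_bigmax i).
(* A lattice vector is encoded by the signs and absolute values of its coordinates. The map need
   only be injective; the two signs account for the 2 in the bound. *)
pose h (l : A) := [ffun i => (val l 0 i < 0, Ordinal (lN l i))].
have h_inj : injective h.
  move=> l1 l2 /ffunP hh; apply/val_inj/rowP => i.
  have := hh i; rewrite !ffunE => -[s e].
  by rewrite [LHS]intEsign [RHS]intEsign s e.
pose g (f : {ffun 'I_n -> bool * 'I_N}) := \prod_i r ^+ (f i).2.
apply: (@le_trans _ _ (\sum_(l : A) g (h l))).
  apply: ler_sum => l _; rewrite /g.
  have -> : \prod_i r ^+ (h l i).2 = expR (\sum_i - (c * `|val l 0%R i|%N%:R)).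
    rewrite expR_sum; apply: eq_bigr => i _.
    by rewrite ffunE /= /r -expRM_natl mulrN mulrC.
  rewrite ler_expR sumrN lerN2.
  apply: (@le_trans _ _ (\sum_(i < n) c * `|vec R (val l)| ^+ 2)).
    apply: ler_sum => i _; rewrite ler_wpM2l ?(ltW c0) //.
    rewrite (@le_trans _ _ (`|vec R (val l) 0 i| ^+ 2)) //; last first.
      by rewrite lerXn2r ?nnegrE // mx_coord_le.
    rewrite mxE -intr_norm -abszE -natrX ler_nat.
    by case: `|_|%N => // k; rewrite expnS expn1 leq_pmulr.
  rewrite sumr_const card_ord -mulr_natl mulrA ler_wpM2r ?sqr_ge0 //.
  by rewrite /c mulrCA ger_pMr // ler_pdivrMr ?mul1r ?ler_nat.
apply: le_trans (sumr_inj_le h_inj _) _.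
  by move=> f; apply: prodr_ge0 => i _; rewrite exprn_ge0.
rewrite /g -(bigA_distr_bigA (fun _ (y : bool * 'I_N) => r ^+ y.2)) /=.
rewrite prodr_const card_ord lerXn2r ?nnegrE //.
- by apply: sumr_ge0 => y _; rewrite exprn_ge0.
- by rewrite mulr_ge0 ?invr_ge0 ?subr_ge0 ?(ltW r1).
rewrite -(pair_bigA _ (fun (_ : bool) (i : 'I_N) => r ^+ i)) /= sumr_const
  card_bool.
by rewrite -[leLHS]mulr_natl ler_wpM2l // sum_geometric_le.
Qed.

(** * Summation over an index set *)

Section Summation.
Variables (R : realType) (I : choiceType).
Local Notation psum := summability.partial_sum.
Local Notation totally := summability.totally.
Local Notation C := (Cplx R).
Implicit Types (f : I -> C) (g : I -> R) (A : {fset I}).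

(** The net of partial sums is monotone and bounded, so it converges to its supremum. *)
Lemma partial_sum_ge0_cvg g (K : R) : (forall i, 0 <= g i) ->
  (forall A, psum g A <= K) -> cvg (psum g @ totally).
Proof.
move=> g_ge0 g_le; pose S := sup (range (psum g)).
have sup_S : has_sup (range (psum g)).
  by split; [exists (psum g fset0), fset0 | exists K => _ [A _ <-]].
apply/cvg_ex; exists S; apply/cvgrPdist_le => e e0.
have [_ [A0 _ <-] SA0] := sup_adherent e0 sup_S.
exists A0 => // A /= A0A.
have AS : psum g A <= S by apply: ub_le_sup; [case: sup_S | exists A].
have A0_le : psum g A0 <= psum g A.
  apply: (@sumr_inj_le _ _ _ (fincl A0A) (fun i => g (val i))) => // x y.
  by move=> /(congr1 val) xy; apply: val_inj.
by rewrite ger0_norm ?subr_ge0 // lerBlDr -lerBlDl (le_trans (ltW SA0)).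
Qed.

(** Write g' = (g' + g) - g: both families are nonnegative, and 0 <= g' + g <= 2 g. *)
Lemma partial_sum_dominated_cvgr g g' (K : R) : (forall i, `|g' i| <= g i) ->
  (forall A, psum g A <= K) -> cvg (psum g' @ totally).
Proof.
move=> g'g g_le.
have gE A : psum g' A = psum (fun i => g' i + g i) A - psum g A.
  by rewrite /psum big_split /= addrK.
have g_cvg : cvg (psum g @ totally).
  by apply: partial_sum_ge0_cvg g_le => i; exact: le_trans (g'g i).
rewrite (funext gE); apply: is_cvgB g_cvg.
apply: (@partial_sum_ge0_cvg _ (2 * K)) => [i|A].
  by rewrite -lerBlDr sub0r; move: (g'g i); rewrite ler_norml => /andP[].
apply: (@le_trans _ _ (2 * psum g A)); last by rewrite ler_wpM2l.
rewrite /psum mulr_sumr ler_sum // => i _.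
by rewrite (_ : 2 = 1 + 1) // mulrDl mul1r lerD2r (le_trans (ler_norm _)).
Qed.

Lemma normc_real (x : R) : `|x%:C : C| = `|x|%:C.
Proof. by rewrite normc_def /= expr0n addr0 sqrtr_sqr. Qed.

Lemma normci : `|'i%C : C| = 1.
Proof. by rewrite normc_def /= expr0n expr1n add0r sqrtr1. Qed.

Lemma normc_ge_Im (z : C) : `|complex.Im z|%:C <= `|z|.
Proof. by rewrite normc_def lecR -sqrtr_sqr ler_wsqrtr // lerDr sqr_ge0. Qed.

(** Positive elements in the order of R[i] are real, so each epsilon or radius over [Cplx R] can be
    replaced by a real one. *)
Lemma gt0_realE (e : C) : 0 < e -> e = (complex.Re e)%:C /\ 0 < complex.Re e.
Proof. by case: e => a b; rewrite ltcE /= => /andP[/eqP -> ?]. Qed.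

Lemma partial_sum_dominated_cvg f g (K : R) : (forall i, `|f i| <= (g i)%:C) ->
  (forall A, psum g A <= K) -> cvg (psum f @ totally).
Proof.
move=> fg g_le.
have Re_cvg : cvg (psum (fun i => complex.Re (f i)) @ totally).
  apply: partial_sum_dominated_cvgr g_le => i; rewrite -lecR.
  exact: le_trans (normc_ge_Re _) (fg i).
have Im_cvg : cvg (psum (fun i => complex.Im (f i)) @ totally).
  apply: partial_sum_dominated_cvgr g_le => i; rewrite -lecR.
  exact: le_trans (normc_ge_Im _) (fg i).
have fE A : psum f A = (psum (fun i => complex.Re (f i)) A)%:C
     + 'i%C * (psum (fun i => complex.Im (f i)) A)%:C :> C.
  rewrite /psum !rmorph_sum mulr_sumr -big_split /=; apply: eq_bigr => i _.
  by rewrite -complexE.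
move: Re_cvg Im_cvg => /cvg_ex[a Re_a] /cvg_ex[b Im_b].
apply/cvg_ex; exists (a%:C + 'i%C * b%:C : C).
apply/cvgrPdist_le => e /gt0_realE[-> e0].
have e2 : 0 < complex.Re e / 2 by rewrite divr_gt0.
move/cvgrPdist_le : Re_a => /(_ _ e2) Re_a.
move/cvgrPdist_le : Im_b => /(_ _ e2) Im_b.
near=> A; rewrite fE opprD addrACA -mulrBr -!rmorphB /=.
rewrite (le_trans (ler_normD _ _)) // normrM normci mul1r !normc_real.
rewrite [leRHS](_ : _ = (complex.Re e / 2)%:C + (complex.Re e / 2)%:C);
  last first.
  by rewrite -rmorphD -splitr.
by rewrite lerD // lecR; near: A.
Unshelve. all: by end_near.
Qed.

Lemma dominated_partial_sum_le f g A : (forall i, `|f i| <= (g i)%:C) ->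
  `|psum f A| <= (psum g A)%:C.
Proof.
move=> fg; rewrite (le_trans (ler_norm_sum _ _ _)) // rmorph_sum.
by apply: ler_sum => i _; exact: fg.
Qed.

(** Every partial sum obeys the bound, and one of them lies within any given e of the sum. *)
Lemma dominated_sum_le f g (K : R) : (forall i, `|f i| <= (g i)%:C) ->
  (forall A, psum g A <= K) -> `|summability.sum f| <= K%:C.
Proof.
move=> fg g_le; apply/ler_addgt0Pr => e e0.
have /cvgrPdist_le/(_ e e0) := partial_sum_dominated_cvg fg g_le.
move=> -[A _ /(_ A (fsubset_refl _)) /= sA].
rewrite -[summability.sum f](subrK (psum f A)) (le_trans (ler_normD _ _)) //
  addrC lerD //.
by rewrite (le_trans (dominated_partial_sum_le _ fg)) // lecR.
Qed.

Lemma sum_eq f s : psum f @ totally --> (s : C) -> summability.sum f = s.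
Proof. by move=> fs; apply: cvg_lim. Qed.

Lemma partial_sumP a f1 f2 (s1 s2 : C) :
  psum f1 @ totally --> s1 -> psum f2 @ totally --> s2 ->
  psum (fun i => a * f1 i + f2 i) @ totally --> a * s1 + s2.
Proof.
move=> c1 c2.
have -> : psum (fun i => a * f1 i + f2 i) = fun A => a * psum f1 A + psum f2 A.
  by apply/funext => A; rewrite /psum big_split /= mulr_sumr.
exact: (cvgD (cvgM (cvg_cst a) c1) c2).
Qed.

Lemma sumP a f1 f2 : cvg (psum f1 @ totally) -> cvg (psum f2 @ totally) ->
  summability.sum (fun i => a * f1 i + f2 i)
  = a * summability.sum f1 + summability.sum f2 :> C.
Proof. move=> c1 c2; apply: sum_eq.
have c1' : psum f1 @ totally --> (summability.sum f1 : C) by exact: c1.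
have c2' : psum f2 @ totally --> (summability.sum f2 : C) by exact: c2.
exact: partial_sumP c1' c2'. Qed.

Lemma dominated_summable f g (K : R) : (forall i, `|f i| <= (g i)%:C) ->
  (forall A, psum g A <= K) ->
  summable [set: I] (fun i => (complex.Re `|f i|)%:E).
Proof.
move=> fg g_le; rewrite /summable (@le_lt_trans _ _ K%:E) ?ltry //.
apply: ge_ereal_sup => _ [A [fA _] <-].
rewrite fsbig_finite //= (eq_bigr (fun i => (complex.Re `|f i|)%:E)) => [|i _];
  last first.
  congr EFin; rewrite ger0_norm //; case: (f i) => a b; exact: sqrtr_ge0.
rewrite sumEFin lee_fin big_seq_fsetE /=; apply: le_trans (g_le (fset_set A)).
by apply: ler_sum => i _; move: (fg (val i)); case: (f _) => a b; rewrite lecR.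
Qed.
End Summation.

(** * The complex exponential *)

Section Exponential.
Variable R : realType.
Local Notation C := (Cplx R).
Implicit Types (a b x : R) (z u : C).

(** The mean value theorem based at 0, for [x] of either sign. The bound on [c] turns an estimate of
    the derivative into one of the next order. *)
Lemma MVT0 (f df : R -> R) x : (forall t : R, is_derive t (1 : R) f (df t)) ->
  exists2 c, `|c| <= `|x| & f x - f 0 = df c * x.
Proof.
move=> f_df.
have f_cont (A : set R) : {within A, continuous f}.
  apply: continuous_subspaceT => t; apply: differentiable_continuous.
  by apply/derivable1_diffP; have [] := f_df t.
have [x0|/ltW x0] := leP 0 x.
  have [c] := MVT_segment x0 (fun t _ => f_df t) (f_cont _).
  rewrite in_itv /= subr0 => /andP[c0 cx] ->; exists c => //.
  by rewrite !ger0_norm.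
have [c] := MVT_segment x0 (fun t _ => f_df t) (f_cont _).
rewrite in_itv /= sub0r => /andP[xc c0] fc; exists c.
  by rewrite !ler0_norm // lerN2.
by rewrite -opprB fc mulrN opprK.
Qed.

Lemma sin_le_norm x : `|sin x| <= `|x|.
Proof.
have [c _] := @MVT0 sin cos x (fun t => is_derive_sin t).
by rewrite sin0 subr0 => ->; rewrite normrM ler_piMl // cos_max.
Qed.

Lemma cosB1_le_sqr x : `|cos x - 1| <= `|x| ^+ 2.
Proof.
have [c cx] := @MVT0 cos (fun t => - sin t) x (fun t => is_derive_cos t).
rewrite cos0 => ->; rewrite normrM normrN expr2 ler_wpM2r //.
exact: le_trans (sin_le_norm _) cx.
Qed.

Lemma cosB1_le_norm x : `|cos x - 1| <= `|x|.
Proof.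
have [c cx] := @MVT0 cos (fun t => - sin t) x (fun t => is_derive_cos t).
by rewrite cos0 => ->; rewrite normrM normrN ler_piMl // sin_max.
Qed.

Lemma sinB_le_sqr x : `|sin x - x| <= `|x| ^+ 2.
Proof.
have [c cx] := @MVT0 (fun t => sin t - t) (fun t => cos t - 1) x
  (fun t => is_deriveB (is_derive_sin t) (is_derive_id t 1)).
rewrite sin0 !subr0 => ->; rewrite normrM expr2 ler_wpM2r //.
exact: le_trans (cosB1_le_norm _) cx.
Qed.

Lemma expRB1_le x : `|expR x - 1| <= expR `|x| * `|x|.
Proof.
have [c cx] := @MVT0 expR expR x (fun t => is_derive_expR t).
rewrite expR0 => ->; rewrite normrM ler_wpM2r // ger0_norm ?expR_ge0 //.
by rewrite ler_expR (le_trans (ler_norm c)).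
Qed.

Lemma expRB1B_le x : `|expR x - 1 - x| <= expR `|x| * `|x| ^+ 2.
Proof.
have [c cx] := @MVT0 (fun t => expR t - t) (fun t => expR t - 1) x
  (fun t => is_deriveB (is_derive_expR t) (is_derive_id t 1)).
rewrite expR0 subr0 -addrAC => ->; rewrite normrM expr2 mulrA ler_wpM2r //.
rewrite (le_trans (expRB1_le _)) // ler_pM ?expR_ge0 //.
by rewrite ler_expR.
Qed.

Lemma cexpD z u : cexp (z + u) = cexp z * cexp u.
Proof.
case: z u => [a b] [c d]; rewrite /cexp /= expRD sinD cosD.
by apply/eqP; rewrite eq_complex /=; apply/andP; split; apply/eqP; ring.
Qed.

Lemma cexp0 : cexp (0 : C) = 1.
Proof. by rewrite /cexp /= expR0 cos0 sin0 mulr1 mulr0. Qed.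

Lemma norm_cexp z : `|cexp z| = (expR (complex.Re z))%:C.
Proof.
rewrite normc_def /= !exprMn -mulrDr cos2Dsin2 mulr1 sqrtr_sqr.
by rewrite ger0_norm ?expR_ge0.
Qed.

Lemma cexp_taylor1_le z (r : R) : `|z| <= r%:C ->
  `|cexp z - 1 - z| <= (4 * r ^+ 2 * expR r)%:C.
Proof.
move=> zr.
have ar : `|complex.Re z| <= r by rewrite -lecR (le_trans (normc_ge_Re _)).
have br : `|complex.Im z| <= r by rewrite -lecR (le_trans (normc_ge_Im _)).
case: z zr ar br => a b /= _ ar br.
have r0 : 0 <= r by apply: le_trans ar.
(* Each of the four real summands is at most r^2 exp r in absolute value, hence the constant 4. *)
have -> : cexp (a +i* b) - 1 - (a +i* b) =
  ((expR a * (cos b - 1) + (expR a - 1 - a))%:C +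
  'i%C * (expR a * (sin b - b) + b * (expR a - 1))%:C : C).
  by apply/eqP; rewrite eq_complex /cexp /=; apply/andP; split; apply/eqP; ring.
apply: le_trans (ler_normD _ _) _.
rewrite normrM normci mul1r !normc_real -rmorphD lecR.
have ea : expR a <= expR r by rewrite ler_expR (le_trans (ler_norm _)).
have ea' : expR `|a| <= expR r by rewrite ler_expR.
have e_ge0 : 0 <= expR r by exact: expR_ge0.
have part1 c : `|c| <= r ^+ 2 -> `|expR a * c| <= expR r * r ^+ 2.
  by move=> cr; rewrite normrM ger0_norm ?expR_ge0 // ler_pM ?expR_ge0.
have part2 : `|expR a - 1 - a| <= expR r * r ^+ 2.
  rewrite (le_trans (expRB1B_le _)) // ler_pM ?expR_ge0 ?sqr_ge0 //.
  by rewrite lerXn2r ?nnegrE.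
have part3 : `|b * (expR a - 1)| <= expR r * r ^+ 2.
  rewrite normrM mulrC expr2 mulrA ler_pM //.
  by rewrite (le_trans (expRB1_le _)) // ler_pM ?expR_ge0.
have b2 : `|b| ^+ 2 <= r ^+ 2 by rewrite lerXn2r ?nnegrE.
have part4 := part1 _ (le_trans (cosB1_le_sqr b) b2).
have part5 := part1 _ (le_trans (sinB_le_sqr b) b2).
have := ler_normD (expR a * (cos b - 1)) (expR a - 1 - a).
have := ler_normD (expR a * (sin b - b)) (b * (expR a - 1)).
rewrite -mulrA [r ^+ 2 * _]mulrC; lra.
Qed.
End Exponential.

(** * Series of exponentials of linear forms *)

Section ExponentialSeries.
Variables (R : realType) (I : choiceType) (V : normedModType (Cplx R)).
Local Notation C := (Cplx R).
Local Notation psum := summability.partial_sum.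
Local Notation totally := summability.totally.
(** [A i] stands for a term at the base point and [N i] for a bound on the norm of the form [L i].
    Of the weight exp(2 d N_i), one factor exp(d N_i) bounds exp |L_i(h)| for |h| <= d, and the
    other absorbs powers of [N i]. *)
Variables (A : I -> C) (L : I -> V -> C) (N g : I -> R) (d K : R).
Hypotheses (L_linear : forall i, linear (L i : V -> C^o))
  (L_le : forall i h, `|L i h| <= (N i)%:C * `|h|)
  (N_ge0 : forall i, 0 <= N i)
  (A_le : forall i, `|A i| <= (g i)%:C)
  (d_gt0 : 0 < d)
  (g_le : forall J : {fset I}, psum (fun i => g i * expR (2 * d * N i)) J <= K).

Let g_ge0 i : 0 <= g i.
Proof. by rewrite -lecR; exact: le_trans (normr_ge0 _) (A_le i). Qed.

Let K_ge0 : 0 <= K.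
Proof.
by apply: le_trans (g_le fset0); rewrite /psum big1 // => -[j j0]; have := j0;
  rewrite in_fset0.
Qed.

Let dominated (f : I -> C) (c : R) :=
  forall i, `|f i| <= (c * (g i * expR (2 * d * N i)))%:C.

Let psum_scale_le c J : 0 <= c ->
  psum (fun i => c * (g i * expR (2 * d * N i))) J <= c * K.
Proof. by move=> c0; rewrite /psum -mulr_sumr ler_wpM2l //; exact: g_le. Qed.

Let dominated_cvg f c : 0 <= c -> dominated f c -> cvg (psum f @ totally).
Proof.
move=> c0 fc; apply: (partial_sum_dominated_cvg fc) => J; exact: psum_scale_le.
Qed.

Let dominated_le f c : 0 <= c -> dominated f c ->
  `|summability.sum f| <= (c * K)%:C.
Proof. by move=> c0 fc; apply: (dominated_sum_le fc) => J;
  exact: psum_scale_le. Qed.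

Let deriv h := summability.sum (fun i => A i * L i h) : C.

Let norm_real (h : V) : `|h| = (complex.Re `|h|)%:C.
Proof. by have := normr_ge0 h; case: `|h| => a b;
  rewrite lecE /= => /andP[/eqP->]. Qed.

Let r_ge0 (h : V) : 0 <= complex.Re `|h|.
Proof. by have := normr_ge0 h; rewrite [X in _ <= X]norm_real lecR. Qed.

Let expR_dN i : N i <= d^-1 * expR (2 * d * N i).
Proof.
rewrite ler_pdivlMl // -mulrA mulr_natl.
have := expR_ge1Dx (d * N i *+ 2); have := mulr_ge0 (ltW d_gt0) (N_ge0 i); lra.
Qed.

(** This is exp t >= t^2 / 2 at t = d N_i, multiplied by exp(d N_i). *)
Let expR_dN2 i : N i ^+ 2 * expR (d * N i) <= 2 / d ^+ 2 * expR (2 * d * N i).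
Proof.
have dN0 : 0 <= d * N i by rewrite mulr_ge0 // ltW.
have := expR_ge1Dxn 1 dN0; rewrite exprMn [2`!%:R](_ : _ = 2) // => le_exp.
rewrite -(mulrA 2 d) (expRM_natl 2) [X in _ <= _ * X]expr2 [leRHS]mulrA
  ler_wpM2r ?expR_ge0 //.
rewrite mulrAC ler_pdivlMr ?exprn_gt0 //; move: le_exp; lra.
Qed.

Let deriv_dominated h : dominated (fun i => A i * L i h) (d^-1 * complex.Re
  `|h|).
Proof.
move=> i; rewrite normrM.
apply: le_trans (ler_pM (normr_ge0 _) (normr_ge0 _) (A_le i) (L_le i h)) _.
have r0 := r_ge0 h; have hr := norm_real h; set r := complex.Re `|h| in hr r0 *.
rewrite hr -!rmorphM lecR.
rewrite [leRHS](_ : _ = g i * (d^-1 * expR (2 * d * N i) * r)); last by ring.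
by rewrite ler_wpM2l // ler_wpM2r.
Qed.

Let term_dominated h : complex.Re `|h| <= d ->
  dominated (fun i => A i * cexp (L i h)) 1.
Proof.
move=> hd i; rewrite normrM mul1r rmorphM.
apply: ler_pM => //; rewrite norm_cexp lecR ler_expR.
apply: le_trans (ler_norm _) _; rewrite -lecR.
apply: le_trans (normc_ge_Re _) _; apply: le_trans (L_le i h) _.
have hr := norm_real h; set r := complex.Re `|h| in hr hd *.
rewrite hr -rmorphM lecR mulrC ler_wpM2r //.
by apply: le_trans hd _; move: d_gt0; lra.
Qed.

Let remainder_dominated h : complex.Re `|h| <= d ->
  dominated (fun i => A i * (cexp (L i h) - 1 - L i h))
    (8 / d ^+ 2 * complex.Re `|h| ^+ 2).
Proof.
move=> hd i; rewrite normrM.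
have Lh : `|L i h| <= (N i * complex.Re `|h|)%:C.
  by rewrite rmorphM /= -norm_real.
apply: le_trans (ler_pM (normr_ge0 _) (normr_ge0 _) (A_le i) (cexp_taylor1_le
  Lh)) _.
rewrite -rmorphM lecR.
rewrite [leRHS](_ : _ = g i *
  (8 / d ^+ 2 * complex.Re `|h| ^+ 2 * expR (2 * d * N i))); last by ring.
apply: ler_wpM2l => //.
apply: (@le_trans _ _ (4 * complex.Re `|h| ^+ 2 * (N i ^+ 2 * expR (d * N i)))).
  rewrite [leLHS](_ : _ = 4 * complex.Re `|h| ^+ 2
    * (N i ^+ 2 * expR (complex.Re `|h| * N i))); last first.
    rewrite (mulrC _ (N i)); ring.
  apply: ler_wpM2l; rewrite ?mulr_ge0 ?sqr_ge0 //.
  by rewrite ler_wpM2l ?sqr_ge0 // ler_expR ler_wpM2r.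
rewrite [leRHS](_ : _ = 4 * complex.Re `|h| ^+ 2
  * (2 / d ^+ 2 * expR (2 * d * N i))); last by ring.
by rewrite ler_wpM2l ?mulr_ge0 ?sqr_ge0.
Qed.

Let deriv_cvg h : cvg (psum (fun i => A i * L i h) @ totally).
Proof.
by apply: dominated_cvg (deriv_dominated h);
  rewrite mulr_ge0 ?invr_ge0 ?(ltW d_gt0).
Qed.

Let deriv_linear : linear (deriv : V -> C^o).
Proof.
move=> a u v; rewrite /deriv -[RHS]/(a * _ + _) -sumP //.
congr (summability.sum _); apply/funext => i.
by rewrite L_linear -[a *: L i u]/(a * L i u) mulrDr mulrCA.
Qed.

(** The linear form [deriv] is bounded by K / d, hence continuous. It is the differential because
    the summed remainder is at most (8 K / d^2) |h|^2. *)
Lemma exp_series_differentiable (F : V -> C) x :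
  (forall h, `|h| < d%:C ->
     F (h + x) = summability.sum (fun i => A i * cexp (L i h))) ->
  differentiable F x.
Proof.
move=> FE.
pose D : {linear V -> C^o} :=
  HB.pack (deriv : V -> C^o) (GRing.isLinear.Build _ _ _ _ _ deriv_linear).
have D_cont : continuous (D : V -> C^o).
  apply/linear_bounded_continuous/linear_boundedP.
  exists (d^-1 * K)%:C; split; first by rewrite complex_real.
  move=> M KM h.
  rewrite (le_trans (dominated_le _ (deriv_dominated h))) //.
    by rewrite mulr_ge0 ?invr_ge0 ?(ltW d_gt0).
  rewrite mulrAC rmorphM /= -norm_real ler_wpM2r //; exact: ltW.
suff FD : F \o shift x = cst (F x) + D +o_ 0 id.
  by apply/diff_locallyP; rewrite (diff_unique D_cont FD).
apply/eqaddoP => e /gt0_realE[-> e0].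
(* The first bound keeps [h] strictly inside the ball of radius [d]; the second makes the quadratic
   remainder at most e |h|. Adding 1 keeps the denominator positive. *)
pose c := Num.min (d / 2) (complex.Re e / (8 / d ^+ 2 * K + 1)).
have c0 : 0 < c.
  rewrite lt_min divr_gt0 //= divr_gt0 // ltr_wpDl //.
  by rewrite !mulr_ge0 // invr_ge0 sqr_ge0.
have cC0 : (0 : C) < c%:C by rewrite ltcR.
near=> h.
have hc : `|h| <= c%:C by near: h; exact: nbhs0_le.
have hr := norm_real h.
have rc : complex.Re `|h| <= c by move: hc; rewrite [X in X <= _]hr lecR.
have L0 i : L i 0 = 0.
  by apply/eqP; rewrite -normr_le0 (le_trans (L_le i 0)) // normr0 mulr0.
have Fx : F x = summability.sum A.
  rewrite -[x]add0r FE ?normr0 ?ltcR //; congr (summability.sum _).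
  by apply/funext => i; rewrite L0 cexp0 mulr1.
have hd : complex.Re `|h| < d.
  apply: le_lt_trans rc _; rewrite /c gt_min; apply/orP; left.
  by move: d_gt0; lra.
have A_cvg : cvg (psum A @ totally).
  rewrite (_ : A = fun i => A i * cexp (L i 0)).
    apply: (@dominated_cvg _ 1) => //; apply: term_dominated.
    by rewrite normr0 ltW.
  by apply/funext => i; rewrite L0 cexp0 mulr1.
have rem_dom := remainder_dominated (ltW hd).
have c8_ge0 : 0 <= 8 / d ^+ 2 * complex.Re `|h| ^+ 2.
  by rewrite !mulr_ge0 ?invr_ge0 ?sqr_ge0.
have -> : (F \o shift x - (cst (F x) + D)) h
    = summability.sum (fun i => A i * (cexp (L i h) - 1 - L i h)).
  have -> : (F \o shift x - (cst (F x) + D)) h = F (h + x) - (F x + deriv h) by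
    [].
  have -> : F (h + x) = summability.sum (fun i => A i * cexp (L i h)).
    by apply: FE; rewrite hr ltcR.
  rewrite Fx /deriv.
  have DA := partial_sumP (a := 1) (@deriv_cvg h : _ --> deriv h) (A_cvg : _
    --> summability.sum A).
  have rem_cvg := dominated_cvg c8_ge0 rem_dom.
  (* The factors 1 give the shape a f1 + f2 in which [partial_sumP] splits a limit. *)
  have -> : (fun i => A i * cexp (L i h)) = (fun i =>
      1 * (A i * (cexp (L i h) - 1 - L i h)) + (1 * (A i * L i h) + A i)).
    by apply/funext => i; ring.
  rewrite (sum_eq (partial_sumP (a := 1) (rem_cvg : _ --> summability.sum _)
    DA)).
  rewrite -/(deriv h); ring.
rewrite (le_trans (dominated_le c8_ge0 rem_dom)) //.
rewrite hr -rmorphM lecR.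
have : complex.Re `|h| * (8 / d ^+ 2 * K + 1) <= complex.Re e.
  rewrite -ler_pdivlMr;
    last by rewrite ltr_wpDl // !mulr_ge0 ?invr_ge0 ?sqr_ge0.
  by apply: le_trans rc _; rewrite /c ge_min lexx orbT.
have := r_ge0 h.
set r := complex.Re `|h|; set k := 8 / d ^+ 2.
move=> r0 rk.
rewrite (_ : k * r ^+ 2 * K = (r * (k * K + 1) - r) * r); last by ring.
rewrite ler_wpM2r //; apply: le_trans rk; rewrite gerBl //.
Unshelve. all: by end_near.
Qed.

End ExponentialSeries.

(** * The theta series *)

Section Theta.
Variables (R : realType) (n : nat) (B : {symmetric 'rV[R]_n}).
Local Notation V := 'rV[R]_n.
Local Notation Q := (quad B).
Local Notation C := (Cplx R).
Local Notation X := (C * 'rV[C]_n)%type.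
Implicit Types (k b c : V) (tau : C) (x h : X).

(** Recovers b from z = b tau - c, as Im z = (Im tau) b. *)
Definition imag_shift x : V := (complex.Im x.1)^-1 *: map_mx (@complex.Im R)
  x.2.

(** Recovers c from z = b tau - c, as Re z = (Re tau) b - c. *)
Definition real_shift x : V :=
  complex.Re x.1 *: imag_shift x - map_mx (@complex.Re R) x.2.

(** The exponent of a theta term without its nonholomorphic part. It is complex linear in the pair
    (tau, z), so an increment of the pair multiplies the exponential by that of a linear form. *)
Definition phase k x : C :=
  (2 * pi)%:C * 'i%C
  * (- (x.1 * (2^-1 * Q k)%:C) - complexified_form B k x.2).

Lemma map_Im_zvar tau b c :
  map_mx (@complex.Im R) (zvar tau b c) = complex.Im tau *: b.
Proof.
apply/rowP => j; rewrite !mxE; case: tau => t1 t2 /=; ring.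
Qed.

Lemma map_Re_zvar tau b c :
  map_mx (@complex.Re R) (zvar tau b c) = complex.Re tau *: b - c.
Proof.
apply/rowP => j; rewrite !mxE; case: tau => t1 t2 /=; ring.
Qed.

Lemma imag_shift_zvar tau b c : 0 < complex.Im tau ->
  imag_shift (tau, zvar tau b c) = b.
Proof. by move=> t0; rewrite /imag_shift /= map_Im_zvar scalerK ?gt_eqF. Qed.

Lemma zvar_shift x : 0 < complex.Im x.1 ->
  x.2 = zvar x.1 (imag_shift x) (real_shift x).
Proof.
case: x => tau z /= t0; apply/rowP => j.
rewrite !mxE /= -/(imag_shift _).
case: tau t0 => t1 t2 /= t0; case: (z 0 j) => a b /=.
apply/eqP; rewrite eq_complex /=; apply/andP; split; apply/eqP; field;
  exact: lt0r_neq0.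
Qed.

Lemma complexified_formE k (w : 'rV[C]_n) :
  complexified_form B k w = \sum_j w 0 j * (B k 'e_j)%:C.
Proof.
rewrite /complexified_form !form_coordE.
apply/eqP; rewrite eq_complex /= !raddf_sum /=; apply/andP; split; apply/eqP;
  apply: eq_bigr => j _; rewrite mxE; case: (w 0 j) => a b /=; ring.
Qed.

Lemma phase_linear k : linear (phase k : X -> C^o).
Proof.
move=> a [t z] [t' z']; rewrite /phase /= !complexified_formE.
have -> : a *: t = a * t by [].
have -> : \sum_j (a *: z + z') 0 j * (B k 'e_j)%:C
  = a * (\sum_j z 0 j * (B k 'e_j)%:C) + \sum_j z' 0 j * (B k 'e_j)%:C.
  rewrite mulr_sumr -big_split /=; apply: eq_bigr => j _.
  by rewrite !mxE mulrDl mulrA.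
rewrite -[RHS]/(a * _ + _); ring.
Qed.

Lemma prod_norm_fst x : `|x.1| <= `|x|.
Proof.
by rewrite prod_normE comparable_le_max ?lexx // real_comparable ?normr_real.
Qed.

Lemma prod_norm_snd x : `|x.2| <= `|x|.
Proof.
by rewrite prod_normE comparable_le_max ?lexx ?orbT // real_comparable
  ?normr_real.
Qed.

Lemma phase_le k h : `|phase k h|
  <= (2 * pi * (`|Q k| + \sum_j `|B k 'e_j|))%:C * `|h|.
Proof.
have pi2 : 0 <= 2 * pi :> R by rewrite mulr_ge0 ?pi_ge0.
rewrite /phase normrM normrM normci mulr1 normc_real (ger0_norm pi2).
rewrite [(2 * pi * (_ + _))%:C]rmorphM /= -mulrA.
apply: ler_wpM2l; first by rewrite lecR.
rewrite (le_trans (ler_normB _ _)) // normrN normrM normc_real rmorphD mulrDl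
  lerD //.
  have half : `|2^-1 * Q k| <= `|Q k|.
    by rewrite normrM ger0_norm // ler_piMl // invf_le1 // ler1n.
  rewrite mulrC; apply: ler_pM (prod_norm_fst h) => //.
    by rewrite -normc_real normr_ge0.
  by rewrite lecR.
rewrite complexified_formE (le_trans (ler_norm_sum _ _ _)) //.
rewrite rmorph_sum mulr_suml ler_sum // => j _.
rewrite normrM normc_real mulrC ler_wpM2l ?lecR //.
exact: le_trans (mx_coord_le _ _ _) (prod_norm_snd _).
Qed.

(** Completing the square in k: negativity of Q at k + b becomes decay of the term. *)
Lemma Re_phase k x : 0 < complex.Im x.1 -> complex.Re (phase k x)
  = pi * complex.Im x.1 * (Q (k + imag_shift x) - Q (imag_shift x)).
Proof.
move=> t0; rewrite quadD addrK /imag_shift formZr /phase /complexified_form.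
case: x t0 => [[t1 t2] z] /= t0; field; exact: lt0r_neq0.
Qed.

Lemma phase_zvar k tau b c : 0 < complex.Im tau ->
  (2 * pi)%:C * 'i%C * (tau * (- (2^-1 * Q (k + b)))%:C)
  + (2 * pi)%:C * 'i%C * (B c (k + 2^-1 *: b))%:C
  = - (pi%:C * 'i%C * complexified_form B b (zvar tau b c))
    + phase k (tau, zvar tau b c).
Proof.
move=> t0; rewrite /phase /complexified_form map_Im_zvar map_Re_zvar /=.
rewrite quadD !(formBr, formDr, formZr) (formC _ c k) (formC _ c b) -!/(Q _).
set kb := B k b; set kc := B k c; set bc := B b c; set bb := Q b; set kk := Q k.
case: tau t0 => [t1 t2] /= t0.
apply/eqP; rewrite eq_complex /=; apply/andP; split; apply/eqP; by field.
Qed.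
End Theta.

(** For b nonzero the only root -a / b falls outside [0, 1]; the side on which it falls and the sign
    of b fix a common sign for a and a + b. *)
Lemma affine_sg (R : realFieldType) (a b : R) :
  (forall t, 0 <= t <= 1 -> a + t * b != 0) -> Num.sg (a + b) = Num.sg a.
Proof.
move=> ab_neq0.
have a0 : a != 0 by have := ab_neq0 0; rewrite mul0r addr0 lexx ler01; exact.
have ab0 : a + b != 0 by have := ab_neq0 1; rewrite mul1r lexx ler01; exact.
have [b0|b0] := eqVneq b 0; first by rewrite b0 addr0.
have : ~~ (0 <= - a / b <= 1).
  by apply/negP => /ab_neq0; rewrite divfK // subrr eqxx.
have [b_gt0|b_lt0|bE] := ltgtP 0 b; last by rewrite -bE eqxx in b0.
  rewrite ler_pdivlMr // ler_pdivrMr // mul0r mul1r negb_and -!ltNge.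
  case/orP => ?; first by rewrite !gtr0_sg //; lra.
  by rewrite !ltr0_sg //; lra.
rewrite ler_ndivlMr // ler_ndivrMr // mul0r mul1r negb_and -!ltNge.
case/orP => ?; first by rewrite !ltr0_sg //; lra.
by rewrite !gtr0_sg //; lra.
Qed.

(** This allows a fixed translation of the lattice to be absorbed at the cost of a factor 2. *)
Lemma sqr_norm_le (R : realType) (V : normedZmodType R) (v w : V) :
  `|v| ^+ 2 <= 2 * `|v + w| ^+ 2 + 2 * `|w| ^+ 2.
Proof.
have : `|v| <= `|v + w| + `|w|.
  by rewrite -{1}[v](addrK w) (le_trans (ler_normB _ _)).
move=> v_le; have : `|v| ^+ 2 <= (`|v + w| + `|w|) ^+ 2.
  by rewrite lerXn2r ?nnegrE // addr_ge0.
have := sqr_ge0 (`|v + w| - `|w|); rewrite sqrrB sqrrD; lra.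
Qed.

(** * Terms of the series in (tau, z): signs, decay and growth of the phase *)

Section TildeTerm.
Variables (R : realType) (n : nat) (B : {symmetric 'rV[R]_n}).
Local Notation V := 'rV[R]_n.
Local Notation Q := (quad B).
Local Notation C := (Cplx R).
Local Notation X := (C * 'rV[C]_n)%type.
Implicit Types (k b c : V) (tau : C) (x h : X).

(** B(D, k + b) is not affine in (tau, z), because b is a quotient by Im tau. Multiplying by Im tau
    > 0 keeps the sign and gives the affine function [psi]. *)
Lemma sg_form_segment D k x h :
  (forall t : R, 0 <= t <= 1 -> 0 < complex.Im (t%:C *: h + x).1 /\
    B D (k + imag_shift (t%:C *: h + x)) != 0) ->
  Num.sg (B D (k + imag_shift (h + x))) = Num.sg (B D (k + imag_shift x)).
Proof.
move=> seg.
pose psi (y : X) := complex.Im y.1 * B D k + B D (map_mx (@complex.Im R) y.2).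
have psiE y : 0 < complex.Im y.1 ->
    psi y = complex.Im y.1 * B D (k + imag_shift y).
  by move=> y0; rewrite formDr formZr mulrDr mulVKf // gt_eqF.
have psi_affine (t : R) : psi (t%:C *: h + x) = psi x + t * psi h.
  rewrite /psi.
  have -> : complex.Im (t%:C *: h + x).1 = t * complex.Im h.1 + complex.Im x.1.
    by case: h x {seg} => [[a b] ?] [[c d] ?] /=; ring.
  have -> : map_mx (@complex.Im R) (t%:C *: h + x).2
      = t *: map_mx (@complex.Im R) h.2 + map_mx (@complex.Im R) x.2.
    apply/rowP => j; rewrite !mxE.
    by case: (h.2 0 j) (x.2 0 j) => a b [c d] /=; ring.
  by rewrite formDr formZr; ring.
have sg_psi y : 0 < complex.Im y.1 ->
    Num.sg (B D (k + imag_shift y)) = Num.sg (psi y).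
  by move=> y0; rewrite psiE // sgrM (gtr0_sg y0) mul1r.
have h1 : h + x = 1%:C *: h + x by rewrite (_ : 1%:C = 1) // scale1r.
have x0 : x = 0%:C *: h + x.
  exact: esym (etrans (congr1 (+%R^~ x) (scale0r h)) (add0r x)).
have Im1 : 0 < complex.Im (h + x).1.
  by rewrite h1; have [] := seg 1; rewrite ?lexx ?ler01.
have Im0 : 0 < complex.Im x.1.
  by have [] := seg 0; rewrite ?lexx ?ler01 // -x0.
rewrite !sg_psi // h1 psi_affine mul1r; apply: affine_sg => t t01.
have [Imt Bt] := seg t t01.
by rewrite -psi_affine psiE // mulf_neq0 // gt_eqF.
Qed.

Variables (Phi : V -> C) (mu : V) (p : 'rV[int]_n).

(** The kernel still depends on (tau, z) through Im tau and b, which is not holomorphic;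
    differentiability relies on its being locally constant. *)
Definition tilde_term x (l : 'rV[int]_n) : C :=
  let k := shifted mu p l in
  cexp ((pi * B k (vec R p))%:C * 'i%C)
  * Phi (Num.sqrt (2 * complex.Im x.1) *: (k + imag_shift x))
  * cexp (phase B k x).

Lemma theta_termE tau b c l : 0 < complex.Im tau ->
  theta_term B Phi mu p tau b c l
  = cexp (- (pi%:C * 'i%C * complexified_form B b (zvar tau b c)))
    * tilde_term (tau, zvar tau b c) l.
Proof.
move=> t0; rewrite /theta_term /tilde_term imag_shift_zvar //=.
rewrite -mulrA /ee -cexpD phase_zvar // cexpD; ring.
Qed.

Lemma tilde_term_shift x h l :
  Phi (Num.sqrt (2 * complex.Im (h + x).1) *: (shifted mu p l + imag_shift (h +
    x)))
    = Phi (Num.sqrt (2 * complex.Im x.1) *: (shifted mu p l + imag_shift x)) ->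
  tilde_term (h + x) l = tilde_term x l * cexp (phase B (shifted mu p l) h).
Proof.
move=> PhiE; rewrite /tilde_term PhiE.
have -> : phase B (shifted mu p l) (h + x)
    = phase B (shifted mu p l) x + phase B (shifted mu p l) h.
  by rewrite addrC -[x]scale1r phase_linear !scale1r.
by rewrite cexpD mulrA.
Qed.

Lemma tilde_term_le (e : R) x : 0 < e -> 0 < complex.Im x.1 ->
  (forall v, `|Phi v| <= 1) ->
  (forall v, Phi v != 0 -> Q v <= - (e * `|v| ^+ 2)) ->
  exists a M : R, [/\ 0 < a, 0 <= M & forall l,
    `|tilde_term x l| <= (M * expR (- (a * `|vec R l| ^+ 2)))%:C].
Proof.
move=> e0 t0 Phi_le1 Phi_neg.
pose T := pi * complex.Im x.1; have T0 : 0 < T by rewrite mulr_gt0 ?pi_gt0.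
pose s := mu + 2^-1 *: vec R p + imag_shift x.
(* With k + b = l + s, the exponent is at most T (- e |l + s|^2 - Q(b)), and |l|^2 <= 2 |l + s|^2 +
   2 |s|^2 yields both constants. *)
exists (T * e / 2), (expR (T * (e * `|s| ^+ 2 - Q (imag_shift x)))); split.
- by rewrite divr_gt0 // mulr_gt0.
- exact: expR_ge0.
move=> l; rewrite /tilde_term; set k := shifted mu p l.
set v := _ *: _; have [->|Phi0] := eqVneq (Phi v) 0.
  rewrite mulr0 mul0r normr0 -[0]/(0%:C) lecR mulr_ge0 ?expR_ge0 //.
rewrite !normrM norm_cexp /= mulr0 !mul0r subrr expR0 mul1r norm_cexp.
apply: le_trans (ler_pM _ _ (Phi_le1 _) (lexx _)) _ => //.
  by rewrite -[0]/(0%:C) lecR expR_ge0.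
rewrite mul1r lecR Re_phase // -expRD ler_expR -/T -/k.
have t2 : 0 < 2 * complex.Im x.1 by rewrite mulr_gt0.
have Qk : Q (k + imag_shift x) <= - (e * `|k + imag_shift x| ^+ 2).
  have := Phi_neg _ Phi0.
  rewrite /v quadZ normrZ exprMn real_normK ?num_real // sqr_sqrtr ?(ltW t2) //.
  by rewrite mulrCA -mulrN ler_pM2l.
have := sqr_norm_le (vec R l) s.
have <- : k + imag_shift x = vec R l + s by rewrite /k /s /shifted !addrA.
rewrite -subr_ge0 -(pmulr_rge0 _ (mulr_gt0 T0 e0)).
have : T * Q (k + imag_shift x) <= T * - (e * `|k + imag_shift x| ^+ 2).
  by rewrite ler_pM2l.
lra.
Qed.

Lemma phase_bound : exists2 c : R, 0 <= c & forall l h,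
  `|phase B (shifted mu p l) h| <= (c * (1 + `|vec R l| ^+ 2))%:C * `|h|.
Proof.
pose c0 := \sum_j \sum_i `|B ('e_j : V) 'e_i|.
pose s := mu + 2^-1 *: vec R p.
have c0_ge0 : 0 <= c0 by apply: sumr_ge0 => j _; apply: sumr_ge0.
(* [2 * c0] covers the quadratic and the linear part of the phase together, using |k| <= 1 + |k|^2.
   The last factor compares 1 + |k|^2 with 1 + |l|^2. *)
pose c := 2 * pi * (2 * c0 * (1 + 2 + 2 * `|s| ^+ 2)).
have pi2 : 0 <= 2 * pi :> R by rewrite mulr_ge0 ?pi_ge0.
exists c.
  by rewrite /c !mulr_ge0 // ?pi_ge0 // addr_ge0 // mulr_ge0 // sqr_ge0.
move=> l h; set k := shifted mu p l.
apply: le_trans (phase_le _ _ _) _; apply: ler_wpM2r => //; rewrite lecR.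
rewrite /c -[leRHS]mulrA ler_wpM2l //.
have Bk : \sum_j `|B k 'e_j| <= c0 * `|k|.
  rewrite mulr_suml ler_sum // => j _.
  by rewrite formC; exact: form_le.
have Qk : `|Q k| <= c0 * `|k| ^+ 2.
  rewrite (le_trans (form_le _ _ _)) // expr2 mulrA ler_wpM2r //.
have := sqr_norm_le k (- s).
have -> : k - s = vec R l by rewrite /k /s /shifted -(addrA (vec R l)) addrK.
rewrite normrN => k_le.
have k1 : `|k| <= 1 + `|k| ^+ 2 by have := normr_ge0 k; nra.
apply: (@le_trans _ _ (2 * c0 * (1 + `|k| ^+ 2))).
  have := ler_wpM2l c0_ge0 k1; lra.
rewrite -[leRHS]mulrA ler_wpM2l ?mulr_ge0 //.
have s2 : 0 <= `|s| ^+ 2 := sqr_ge0 _.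
have l2 : 0 <= `|vec R l| ^+ 2 := sqr_ge0 _.
have := mulr_ge0 s2 l2; lra.
Qed.
End TildeTerm.

(** * Convergence and differentiability for a bounded kernel supported where Q is uniformly
    negative *)

Section ThetaTilde.
Variables (R : realType) (n : nat) (B : {symmetric 'rV[R]_n}).
Local Notation V := 'rV[R]_n.
Local Notation Q := (quad B).
Local Notation C := (Cplx R).
Local Notation X := (C * 'rV[C]_n)%type.
Local Notation psum := summability.partial_sum.
Local Notation totally := summability.totally.
Variables (Phi : V -> C) (mu : V) (p : 'rV[int]_n) (e : R).
Hypotheses (e0 : 0 < e) (Phi_le1 : forall v, `|Phi v| <= 1)
  (Phi_neg : forall v, Phi v != 0 -> Q v <= - (e * `|v| ^+ 2)).

Definition theta_tilde (x : X) : C :=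
  summability.sum (tilde_term B Phi mu p x).

Lemma gaussian_dominated (f : 'rV[int]_n -> C) (a M : R) : 0 < a -> 0 <= M ->
  (forall l, `|f l| <= (M * expR (- (a * `|vec R l| ^+ 2)))%:C) ->
  summable [set: 'rV[int]_n] (fun l => (complex.Re `|f l|)%:E)
  /\ cvg (psum f @ totally).
Proof.
move=> a0 M0 f_le; have [K sum_le] := gaussian_lattice_sum n a0.
have psum_le (J : {fset 'rV[int]_n}) : psum (fun l => M * expR (- (a * `|vec R
  l| ^+ 2))) J <= M * K.
  by rewrite /psum -mulr_sumr ler_wpM2l //; exact: sum_le.
split; first exact: dominated_summable f_le psum_le.
exact: partial_sum_dominated_cvg f_le psum_le.
Qed.

Lemma tilde_term_cvg x : 0 < complex.Im x.1 ->
  cvg (psum (tilde_term B Phi mu p x) @ totally).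
Proof.
move=> t0; have [a [M [a0 M0 f_le]]] := tilde_term_le mu p e0 t0 Phi_le1
  Phi_neg.
by have [] := gaussian_dominated a0 M0 f_le.
Qed.

Lemma theta_term_convergent tau b c : 0 < complex.Im tau ->
  theta_convergent B Phi mu p tau b c.
Proof.
move=> t0; have t0' : 0 < complex.Im (tau, zvar tau b c).1 by [].
have [a [M [a0 M0 f_le]]] := tilde_term_le mu p e0 t0' Phi_le1 Phi_neg.
set w := - (pi%:C * 'i%C * complexified_form B b (zvar tau b c)).
apply: (@gaussian_dominated _ a (expR (complex.Re w) * M)) => //.
  by rewrite mulr_ge0 ?expR_ge0.
move=> l; rewrite theta_termE // -/w normrM norm_cexp -[_ * M * _]mulrA rmorphM
  /=.
by rewrite ler_wpM2l // -[0]/(0%:C) lecR expR_ge0.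
Qed.

(** The power of Im tau is 1 at weight 0. The common exponential factor leaves the limit once the
    series in (tau, z) is known to converge. *)
Lemma theta_tildeE tau b c : 0 < complex.Im tau ->
  theta B Phi 0 mu p tau b c
  = cexp (- (pi%:C * 'i%C * complexified_form B b (zvar tau b c)))
    * theta_tilde (tau, zvar tau b c).
Proof.
move=> t0; rewrite /theta mul0r oppr0 powRr0 mul1r.
have f_cvg : psum (tilde_term B Phi mu p (tau, zvar tau b c)) @ totally
    --> theta_tilde (tau, zvar tau b c) by exact: (@tilde_term_cvg (tau, _)).
apply: sum_eq.
set w := cexp _; set f := tilde_term _ _ _ _ _ in f_cvg *.
have -> : psum (theta_term B Phi mu p tau b c) = fun J => w * psum f J.
  apply/funext => J; rewrite /psum mulr_sumr; apply: eq_bigr => l _.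
  exact: theta_termE.
exact: (cvgM (cvg_cst w) f_cvg).
Qed.

Lemma theta_tilde_differentiable (x : X) (r : R) : 0 < complex.Im x.1 -> 0 < r
  ->
  (forall h : X, `|h| < r%:C -> forall l,
    let k := shifted mu p l in
    Phi (Num.sqrt (2 * complex.Im (h + x).1) *: (k + imag_shift (h + x)))
    = Phi (Num.sqrt (2 * complex.Im x.1) *: (k + imag_shift x))) ->
  differentiable theta_tilde x.
Proof.
move=> t0 r0 Phi_const.
have [a [M [a0 M0 f_le]]] := tilde_term_le mu p e0 t0 Phi_le1 Phi_neg.
have [c c0 phase_le] := phase_bound B mu p.
have [K sum_le] := gaussian_lattice_sum n (divr_gt0 a0 (ltr0Sn R 1)).
(* The radius [r] keeps the kernel constant. The other bound gives 2 d c <= a / 2, so half of the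
   Gaussian rate [a] absorbs the weight exp(2 d c (1 + |l|^2)) and the rate a / 2 is left; c + 1
   avoids division by zero. *)
pose d := Num.min r (a / (4 * (c + 1))).
have c1 : 0 < 4 * (c + 1) by rewrite mulr_gt0 // ltr_wpDl.
have d0 : 0 < d by rewrite lt_min r0 divr_gt0.
have dc : 2 * d * c <= a / 2.
  have : d <= a / (4 * (c + 1)) by rewrite /d ge_min lexx orbT.
  rewrite ler_pdivlMr //; move: d0 c0 => /ltW; nra.
apply: (@exp_series_differentiable _ _ _ (tilde_term B Phi mu p x)
  (fun l => phase B (shifted mu p l)) (fun l => c * (1 + `|vec R l| ^+ 2))
  (fun l => M * expR (- (a * `|vec R l| ^+ 2))) d (M * (expR (a / 2) * K))) =>
    //.
- by move=> l; exact: phase_linear.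
- by move=> l; rewrite mulr_ge0 // addr_ge0 // sqr_ge0.
- move=> J; apply: (@le_trans _ _
    (psum (fun l => M * (expR (a / 2) * expR (- (a / 2 * `|vec R l| ^+ 2))))
      J)).
    apply: ler_sum => l _; rewrite -mulrA ler_wpM2l // -!expRD ler_expR.
    have := sqr_ge0 `|vec R (val l)|; nra.
  rewrite /psum -!mulr_sumr ler_wpM2l // ler_wpM2l ?expR_ge0 //; exact: sum_le.
move=> h hd; congr (summability.sum _); apply/funext => l.
apply: tilde_term_shift; apply: Phi_const; apply: lt_le_trans hd _.
by rewrite lecR /d ge_min lexx.
Qed.
End ThetaTilde.

(** * The kernel [Phi2]: its support and its local constancy *)

Section Kernel.
Variables (R : realType) (n : nat) (B : {symmetric 'rV[R]_n}).
Variables (C1 C1' C2 C2' : 'rV[R]_n).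
Local Notation Phi := (Phi2 B C1 C1' C2 C2').
Local Notation Cs := [:: C1; C1'; C2; C2'].

Lemma norm_Phi2_le1 v : `|Phi v| <= 1.
Proof.
rewrite normc_real -[leRHS]/(1%:C) lecR.
have sg_le (a b : R) : `|Num.sg a - Num.sg b| <= 2.
  rewrite (le_trans (ler_normB _ _)) // -[leRHS]/(1 + 1) lerD //;
    by rewrite normr_sg lern1 leq_b1.
rewrite -mulrA normrM (@ger0_norm _ 4^-1) ?invr_ge0 // ler_pdivrMl // mulr1
  normrM.
by rewrite (_ : 4 = 2 * 2) ?ler_pM // -natrM.
Qed.

(** Numbers with positive product have the same sign, so their factor of the kernel vanishes. A zero
    product may survive since the sign of 0 is 0; the resulting cone is closed, as the compactness
    argument requires. *)
Lemma Phi2_neq0 v : Phi v != 0 ->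
  B C1 v * B C1' v <= 0 /\ B C2 v * B C2' v <= 0.
Proof.
have sg_neq (a b : R) : Num.sg a - Num.sg b != 0 -> a * b <= 0.
  apply: contraNT; rewrite -ltNge => ab; rewrite subr_eq0.
  have : Num.sg a * Num.sg b = 1 by rewrite -sgrM gtr0_sg.
  by case: (sgrP a) => _; case: (sgrP b) => _; rewrite ?mulr0 ?mul0r; lra.
rewrite /Phi2 => Phi0; split; apply: sg_neq; apply: contraNneq Phi0 => ->.
  by rewrite mulr0 mul0r.
by rewrite mulr0.
Qed.

Lemma Phi2_sg v w :
  (forall D, D \in Cs -> Num.sg (B D v) = Num.sg (B D w)) -> Phi v = Phi w.
Proof. by move=> sgE; rewrite /Phi2 !sgE // !inE eqxx ?orbT. Qed.

Lemma Phi2Z (a : R) v : 0 < a -> Phi (a *: v) = Phi v.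
Proof. by move=> a0; apply: Phi2_sg => D _;
  rewrite formZr sgrM gtr0_sg // mul1r. Qed.

(** The radius does not depend on the lattice point: it is that of a ball inside [U], and [U] avoids
    the loci of all lattice points at once. *)
Lemma Phi2_locally_const mu p (U : set (Cplx R * 'rV[Cplx R]_n)) x :
  open U -> U `<=` off_loci B Cs mu p -> U x ->
  exists2 r : R, 0 < r & forall h, `|h| < r%:C -> forall l,
    let k := shifted mu p l in
    Phi (Num.sqrt (2 * complex.Im (h + x).1) *: (k + imag_shift (h + x)))
    = Phi (Num.sqrt (2 * complex.Im x.1) *: (k + imag_shift x)).
Proof.
move=> U_open U_off Ux.
have /nbhs_normP[r /= /gt0_realE[rE r0] ballU] : nbhs x U by exact:
  open_nbhs_nbhs.
exists (complex.Re r) => // h; rewrite -rE => hr l; set k := shifted mu p l.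
(* The ball is convex, so the whole segment from [x] to [h + x] stays in [U]. *)
have seg (t : R) : 0 <= t <= 1 -> U (t%:C *: h + x).
  move=> /andP[t0 t1]; apply: ballU => /=.
  rewrite opprD addrCA subrr addr0 normrN normrZ normc_real ger0_norm //.
  apply: le_lt_trans hr; rewrite ler_piMl // -[leRHS]/(1%:C) lecR //.
have off (t : R) D : 0 <= t <= 1 -> D \in Cs ->
    0 < complex.Im (t%:C *: h + x).1 /\ B D (k + imag_shift (t%:C *: h + x)) !=
      0.
  move=> t01 Ds; have [Im_gt0 loci] := U_off _ (seg t t01); split => //.
  exact: loci (zvar_shift Im_gt0) _ Ds _.
have C1s : C1 \in Cs by rewrite inE eqxx.
have h1 : 1%:C *: h + x = h + x by rewrite (_ : 1%:C = 1) // scale1r.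
have Im1 : 0 < complex.Im (h + x).1.
  by rewrite -h1; have [] := off 1 C1; rewrite ?lexx ?ler01.
have Im0 : 0 < complex.Im x.1 by have [] := U_off _ Ux.
rewrite !Phi2Z ?sqrtr_gt0 ?mulr_gt0 //.
by apply: Phi2_sg => D Ds; apply: sg_form_segment => t t01; exact: off.
Qed.
End Kernel.

Theorem theorem4p1 (R : realType) (n : nat) (B : {symmetric 'rV[R]_n})
    (p : 'rV[int]_n) (mu C1 C1' C2 C2' : 'rV[R]_n)
    (B_integer : integer_valued B)
    (B_signature : has_signature B 2%N (n - 2)%N)
    (p_characteristic : characteristic B p)
    (mu_dual : dual_lattice B mu)
    (C_positive : [/\ 0 < quad B C1, 0 < quad B C1',
                      0 < quad B C2 & 0 < quad B C2'])
    (Delta_positive : 0 < Delta B [:: C1; C1'; C2; C2'])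
    (D11'_ge0 : 0 <= Dcof B C1 C1' C2 C2' 0%N 1%N)
    (D22'_ge0 : 0 <= Dcof B C1 C1' C2 C2' 2%N 3%N)
    (M_negative : negative_definite (Mmat B C1 C1' C2 C2')) :
  let Phi := Phi2 B C1 C1' C2 C2' in
  (forall (tau : Cplx R) (b c : 'rV[R]_n), 0 < complex.Im tau ->
     theta_convergent B Phi mu p tau b c)
  /\ exists theta_tilde : Cplx R * 'rV[Cplx R]_n -> Cplx R,
     (forall (tau : Cplx R) (b c : 'rV[R]_n), 0 < complex.Im tau ->
        theta B Phi 0 mu p tau b c
        = cexp (- (pi%:C * 'i%C * complexified_form B b (zvar tau b c)))
          * theta_tilde (tau, zvar tau b c))
     /\ (forall U : set (Cplx R * 'rV[Cplx R]_n), open U ->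
           U `<=` off_loci B [:: C1; C1'; C2; C2'] mu p ->
           holomorphic_on U theta_tilde).

Proof.
move=> Phi; case: C_positive => C1_gt0 _ _ _.
have [e e0 cone_le] := cone_quad_le (fun x => @cone_quad_lt0 _ _ _ _ _ _ _ x
  B_signature C1_gt0 Delta_positive D11'_ge0 D22'_ge0 M_negative).
have Phi_neg v : Phi v != 0 -> quad B v <= - (e * `|v| ^+ 2).
  by move=> /Phi2_neq0[? ?]; exact: cone_le.
have Phi_le1 := norm_Phi2_le1 B C1 C1' C2 C2'.
split; first by move=> tau b c t0;
  apply: (@theta_term_convergent _ _ _ _ _ _ e).
(* One function of (tau, z) serves for every open set [U]; only the radius found below depends on
   [U] and the point. *)
exists (theta_tilde B Phi mu p); split.
  by move=> tau b c t0; exact: (theta_tildeE mu p e0 Phi_le1 Phi_neg b c t0).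
move=> U U_open U_off; split=> // x Ux.
have [r r0 Phi_const] := Phi2_locally_const U_open U_off Ux.
have [Im_gt0 _] := U_off _ Ux.
by apply: (@theta_tilde_differentiable _ _ _ _ _ _ e _ _ _ x r).
Qed.
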